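(* Let $\mathsf X=\mathbb R^d$ and let $\tilde P$ be the pseudo-marginal kernel with weight distributions $\{Q_x\}_{x\in\mathsf X}$ whose marginal algorithm is a random-walk Metropolis with invariant density $\pi$ and symmetric increment proposal density $q$. Suppose that: (1) for some constants $\alpha'>0$ and $\beta'>1$, $M_W:=\operatorname{ess\,sup}_{x\in\mathsf X}\int(w^{-\alpha'}\vee w^{\beta'})Q_x(\mathrm dw)<\infty$ (essential supremum with respect to Lebesgue measure); (2) $\pi$ is a continuously differentiable probability density with respect to Lebesgue measure supported on $\mathbb R^d$ with $$\lim_{|x|\to\infty}\frac x{|x|}\cdot\nabla\log\pi(x)=-\infty\quad\text{and}\quad\limsup_{|x|\to\infty}\frac x{|x|}\cdot\frac{\nabla\pi(x)}{|\nabla\pi(x)|}<0,$$ and $q$ is bounded away from zero in some neighbourhood of the origin. Define $V:\mathsf X\times\mathsf W\to[1,\infty)$ by $$V(x,w):=c_\pi^\eta\pi^{-\eta}(x)(w^{-\alpha}\vee w^\beta),\qquad c_\pi:=\sup_{z\in\mathsf X}\pi(z),$$ for some constants $\eta\in(0,\alpha'\wedge1)$, $\alpha\in(\eta,\alpha']$ and $\beta\in(0,\beta'-\eta)$. Then there exist constants $\bar w,M,b\in[1,\infty)$, $\underline w\in(0,1]$ and $\delta_V>0$ such that $$\tilde PV(x,w)\le\begin{cases}V(x,w)-\delta_VV^{(\beta-1)/\beta}(x,w),&\text{for all }(x,w)\notin\mathsf C,\\ b,&\text{for all }(x,w)\in\mathsf C,\end{cases}$$ where $\mathsf C:=\{(x,w)\in\mathsf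 X\times\mathsf W:|x|\le M,\ w\in[\underline w,\bar w]\}$. Moreover, $b$, $\delta_V$ and $\mathsf C$ depend only on the marginal algorithm (i.e. on $\pi$ and $q$), the constants $\alpha',\beta',M_W$ and the chosen constants $\alpha,\beta,\eta$.
   Context: The proposal kernel is $q(x,\mathrm dy)=q(y-x)\,\mathrm dy$ with $q$ a symmetric probability density on $\mathbb R^d$; the marginal random-walk Metropolis has acceptance probability $\min\{1,\pi(y)/\pi(x)\}$. ''Supported on $\mathbb R^d$'' means $\pi(x)>0$ for all $x\in\mathbb R^d$. $|x|$ is the Euclidean norm, $a\vee b=\max\{a,b\}$, $a\wedge b=\min\{a,b\}$. $\mathsf W$ is a Borel subset of $(0,\infty)$ and $x\mapsto Q_x$ is a probability kernel from $\mathsf X$ to $\mathsf W$ with $\int w\,Q_x(\mathrm dw)=1$ for all $x$. The pseudo-marginal kernel on $\mathsf X\times\mathsf W$ is $$\tilde P(x,w;\mathrm dy,\mathrm du)=\min\Bigl\{1,\frac{\pi(y)}{\pi(x)}\frac uw\Bigr\}q(y-x)\,\mathrm dy\,Q_y(\mathrm du)+\delta_{x,w}(\mathrm dy,\mathrm du)\tilde\rho(x,w),$$ with $\tilde\rho(x,w)=1-\iint\min\{1,\frac{\pi(y)}{\pi(x)}\frac uw\}q(y-x)\,\mathrm dy\,Q_y(\mathrm du)$, and $\tilde PV(x,w)=\int\tilde P(x,w;\mathrm dy,\mathrm du)V(y,u)$. *)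

(* Defs.v *)
From HB Require Import structures.
From mathcomp Require Import all_boot all_order all_algebra.
From mathcomp Require Import all_classical all_reals all_analysis.

Set Implicit Arguments.
Unset Strict Implicit.
Unset Printing Implicit Defensive.

Import Order.TTheory GRing.Theory Num.Theory.
Import numFieldNormedType.Exports.

Local Open Scope classical_set_scope.
Local Open Scope ring_scope.

(* The Borel sigma-algebra of R^d, presented as the product sigma-algebra
   generated by the coordinates, as the library does for [n.-tuple T]. *)
Definition rV_display : measure_display.
Proof. exact: default_measure_display. Qed.

Section measurable_rV.
Context {R : realType} {d : nat}.

Let coord : 'I_d -> 'rV[R]_d -> R := fun i x => x ord0 i.

Let rV_set0 : g_sigma_preimage coord set0.
Proof. exact: sigma_algebra0. Qed.

Let rV_setC A : g_sigma_preimage coord A -> g_sigma_preimage coord (~` A).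
Proof. exact: sigma_algebraC. Qed.

Let rV_bigcup (F : (set 'rV[R]_d)^nat) :
  (forall i, g_sigma_preimage coord (F i)) ->
  g_sigma_preimage coord (\bigcup_i (F i)).
Proof. exact: sigma_algebra_bigcup. Qed.

HB.instance Definition _ := @isMeasurable.Build rV_display
  'rV[R]_d (g_sigma_preimage coord) rV_set0 rV_setC rV_bigcup.

Lemma measurable_coord (i : 'I_d) :
  measurable_fun [set: 'rV[R]_d] (fun x : 'rV[R]_d => x ord0 i).
Proof.
move=> _ Y mY; rewrite setTI; apply: sub_sigma_algebra => /=.
rewrite -bigcup_seq/=; exists i => /=; first by rewrite mem_index_enum.
by exists Y => //; rewrite setTI.
Qed.

Lemma measurable_fun_rVP d1 (T1 : measurableType d1) (f : T1 -> 'rV[R]_d) :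
  (forall i, measurable_fun [set: T1] (fun t => f t ord0 i)) ->
  measurable_fun [set: T1] f.
Proof.
move=> mf _ A mA; rewrite setTI.
suff: measurable `<=` [set B | measurable (f @^-1` B)] by exact.
apply: smallest_sub.
  split => /=.
  - by rewrite preimage_set0.
  - by move=> B mB; rewrite setTD preimage_setC; exact: measurableC.
  - by move=> F mF; rewrite preimage_bigcup; exact: bigcupT_measurable.
rewrite -bigcup_seq/= => B [i _ [C mC <-]] /=.
by rewrite setTI; have := mf i measurableT C mC; rewrite setTI.
Qed.

End measurable_rV.

Section lebesgue_rV_step.
Context {R : realType} {d : nat}.

Definition cons_rV (z : measurableTypeR R * 'rV[R]_d) : 'rV[R]_d.+1 :=
  \row_i oapp (z.2 ord0) z.1 (unlift ord0 i).

Definition uncons_rV (x : 'rV[R]_d.+1) : measurableTypeR R * 'rV[R]_d :=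
  (x ord0 ord0, \row_i x ord0 (lift ord0 i)).

Lemma cons_rVK : cancel cons_rV uncons_rV.
Proof.
move=> [t v]; congr pair; first by rewrite mxE unlift_none.
by apply/rowP => i; rewrite !mxE liftK.
Qed.

Lemma uncons_rVK : cancel uncons_rV cons_rV.
Proof.
move=> x; apply/rowP => i; rewrite mxE.
by case: unliftP => [j|] -> //=; rewrite mxE.
Qed.

Lemma measurable_cons_rV : measurable_fun setT cons_rV.
Proof.
apply: measurable_fun_rVP => i.
case: (unliftP ord0 i) => [j ->|->].
- rewrite (_ : (fun _ => _) = (fun x : 'rV[R]_d => x ord0 j) \o snd).
    by apply: measurableT_comp; [exact: measurable_coord|exact: measurable_snd].
  by apply/funext => -[t v]; rewrite /= mxE liftK.
- rewrite (_ : (fun _ => _) = fst); first exact: measurable_fst.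
  by apply/funext => -[t v]; rewrite /= mxE unlift_none.
Qed.

Lemma measurable_uncons_rV : measurable_fun setT uncons_rV.
Proof.
apply/measurable_fun_pairP; split; first exact: measurable_coord.
apply: measurable_fun_rVP => i.
rewrite (_ : (fun _ => _) = fun x : 'rV[R]_d.+1 => x ord0 (lift ord0 i)).
  exact: measurable_coord.
by apply/funext => x; rewrite /= mxE.
Qed.

Variable m : {sigma_finite_measure set 'rV[R]_d -> \bar R}.

Definition lebesgue_rV_step : set 'rV[R]_d.+1 -> \bar R :=
  pushforward (lebesgue_measure \x m)%E cons_rV.

Let step_measure : {measure set 'rV[R]_d.+1 -> \bar R} :=
  measure_function_pushforward__canonical__measure_function_Measure
    (lebesgue_measure \x m)%E measurable_cons_rV.

HB.instance Definition _ := isMeasure.Build _ _ _ lebesgue_rV_step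
  (measure0 step_measure) (measure_ge0 step_measure)
  (@measure_semi_sigma_additive _ _ _ step_measure).

Let step_sigma_finite : sigma_finite setT lebesgue_rV_step.
Proof.
have /sigma_finiteP[F [FT ndF mF]] := sigma_finiteT (@lebesgue_measure R).
have /sigma_finiteP[G [GT ndG mG]] := sigma_finiteT m.
exists (fun n => uncons_rV @^-1` (F n `*` G n)).
  rewrite -preimage_bigcup -[LHS](preimage_setT uncons_rV); congr (_ @^-1` _).
  rewrite -setXTT FT GT; apply/seteqP; split=> [[x y]|[x y] [n _ []]]/=.
    move=> [/= [n _ Fnx] [k _ Gky]]; exists (maxn n k) => //; split.
    - by move: x Fnx; exact/subsetPset/ndF/leq_maxl.
    - by move: y Gky; exact/subsetPset/ndG/leq_maxr.
  by split; exists n.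
move=> n; have [mFn Fnoo] := mF n; have [mGn Gnoo] := mG n; split.
  rewrite -[X in measurable X]setTI; apply: measurable_uncons_rV => //.
  exact: measurableX.
rewrite /lebesgue_rV_step /pushforward -comp_preimage.
rewrite (_ : _ \o _ = id); last by apply/funext => z; rewrite /= cons_rVK.
rewrite preimage_id product_measure1E//.
by rewrite lte_mul_pinfty// ge0_fin_numE.
Qed.

HB.instance Definition _ := Measure_isSigmaFinite.Build _ _ _
  lebesgue_rV_step step_sigma_finite.

End lebesgue_rV_step.

(* Lebesgue measure on R^d, as the d-fold product of Lebesgue measure on R
   (see [lebesgue_rV_box]). *)
Fixpoint lebesgue_rV {R : realType} (d : nat) :
    {sigma_finite_measure set 'rV[R]_d -> \bar R} :=
  if d is d'.+1 then lebesgue_rV_step (lebesgue_rV d') else \d_(0 : 'rV[R]_0).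

Lemma lebesgue_rV_box {R : realType} (d : nat)
    (A : 'I_d -> set (measurableTypeR R)) :
  (forall i, measurable (A i)) ->
  lebesgue_rV d [set x : 'rV[R]_d | forall i, A i (x ord0 i)] =
  (\prod_(i < d) lebesgue_measure (A i))%E.
Proof.
elim: d A => [|d IH] A mA.
  by rewrite big_ord0 /= diracE mem_set// => -[].
rewrite big_ord_recl -IH//= -product_measure1E//.
  congr (product_measure1 _ _ _); apply/seteqP; split => [[t v]|[t v] [/= At Av] i] /=.
    move=> tv; split => /=; first by have := tv ord0; rewrite mxE unlift_none.
    by move=> i; have := tv (lift ord0 i); rewrite mxE liftK.
  by rewrite mxE; case: unliftP => [j|] ->.
rewrite (_ : mkset _ = \big[setI/setT]_(i < d)
    ((fun x : 'rV[R]_d => x ord0 i) @^-1` A (lift ord0 i))).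
  apply: bigsetI_measurable => i _; rewrite -[X in measurable X]setTI.
  by apply: (measurable_coord i); [exact: measurableT|exact: mA].
rewrite -bigcap_seq; apply/seteqP; split => x /= h i.
  by move=> _; exact: h.
by apply: h; exact: mem_index_enum.
Qed.

Section euclidean.
Context {R : realType} {d : nat}.
Implicit Types x y : 'rV[R]_d.

Definition dotr x y : R := \sum_i x ord0 i * y ord0 i.

(* The library norm of ['rV[R]_d] is the sup norm. *)
Definition enorm x : R := Num.sqrt (dotr x x).

Definition unitv x : 'rV[R]_d := (enorm x)^-1 *: x.

Definition gradient (f : 'rV[R]_d -> R) x : 'rV[R]_d :=
  \row_i 'D_(delta_mx ord0 i) f x.

Definition infty_nbhs : set_system 'rV[R]_d :=
  filter_from [set: R] (fun r => [set x | r < enorm x]).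

Definition C1 (f : 'rV[R]_d -> R) : Prop :=
  (forall x, differentiable f x) /\ continuous (gradient f).

Definition probability_density (f : 'rV[R]_d -> R) : Prop :=
  [/\ measurable_fun setT f, forall x, 0 <= f x &
      (\int[lebesgue_rV d]_x (f x)%:E = 1)%E].

End euclidean.

(* The weight space W is a Borel subset of R and a probability kernel from X to
   W is a probability kernel to R that gives no mass to the complement of W. *)
Section pseudo_marginal.
Context {R : realType} {d : nat}.
Variables (pi q : 'rV[R]_d -> R) (W : set R) (Q : R.-pker 'rV[R]_d ~> R).

Definition weight_kernel : Prop :=
  [/\ measurable W, W `<=` `]0, +oo[, forall x, Q x (~` W) = 0%E &
      forall x, (\int[Q x]_(w in W) w%:E = 1)%E].

Definition pm_acceptance (x : 'rV[R]_d) (w : R) (y : 'rV[R]_d) (u : R) : R :=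
  Num.min 1 (pi y / pi x * (u / w)).

Definition pm_rejection (x : 'rV[R]_d) (w : R) : \bar R :=
  (1 - \int[lebesgue_rV d]_y \int[Q y]_(u in W)
         (pm_acceptance x w y u * q (y - x))%:E)%E.

Definition pm_kernel (z : 'rV[R]_d * R) : set ('rV[R]_d * R) -> \bar R :=
  fun A =>
    (\int[lebesgue_rV d]_y \int[Q y]_(u in W)
       (pm_acceptance z.1 z.2 y u * q (y - z.1) * \1_A (y, u))%:E
     + pm_rejection z.1 z.2 * \d_z A)%E.

Definition pm_apply (V : 'rV[R]_d * R -> R) (z : 'rV[R]_d * R) : \bar R :=
  (\int[pm_kernel z]_(z' in setT `*` W) (V z')%:E)%E.

Definition pm_lyapunov (eta alpha beta : R) (z : 'rV[R]_d * R) : R :=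
  sup (range pi) `^ eta * pi z.1 `^ (- eta) *
  Num.max (z.2 `^ (- alpha)) (z.2 `^ beta).

End pseudo_marginal.

(* Main.v *)
Require Import Defs.
From HB Require Import structures.
From mathcomp Require Import all_boot all_order all_algebra.
From mathcomp Require Import all_classical all_reals all_analysis ess_sup_inf.
From mathcomp Require Import measurable_realfun.
From mathcomp Require Import ring lra.

Set Implicit Arguments.
Unset Strict Implicit.
Unset Printing Implicit Defensive.

Import Order.TTheory GRing.Theory Num.Theory.
Import numFieldNormedType.Exports.

Local Open Scope classical_set_scope.
Local Open Scope ring_scope.

(** The drift of V at (x, w) is governed by the ratio r = pi y / pi x of a
    proposed point y.  Dividing by V (x, w), a proposal y with weight u
    contributes a * (r ^ - eta * psi u / psi w) against a, where
    a = min 1 (r u / w) is the acceptance probability and psi is the weight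
    factor of V; V decreases at (x, w) as soon as the first quantity, averaged
    over y and u, falls short of the second.  [pm_drift] makes this precise
    without subtracting integrals: an inequality between the two weight
    integrals, given for almost every y with a gain f and a loss g, becomes a
    drift inequality after integration against the proposal density.

    Since min 1 t <= t ^ p for p in [0, 1], the first quantity is at most
    r ^ (p - eta) * w ^ - p * M / psi w as long as p + beta <= beta', M being
    the moment bound ([accepted_drift_le]).  In the other direction, by Markov's
    inequality the weight is of order one with probability at least 1 / 2, which
    bounds the accepted mass from below ([accepted_mass_ge]).  Three regimes of
    the weight w follow.
    - Small w: with p = eta the first quantity is of order w ^ (alpha - eta),
      while proposals with r bounded below are accepted with a probability
      bounded below; V decreases by a fixed proportion.
    - Large w: proposals with r bounded below bring a gain of order 1 / w, and
      all others a loss of order w ^ - (beta + p) for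
      p = min 1 (beta' - beta), where beta + p > 1; V decreases by a proportion
      1 / w, which is at least V ^ (- 1 / beta).
    - Intermediate w, x far from the origin: very small r contributes little
      (take p > eta), very large r is accepted and brings a gain, and r of
      order one is harmless because such y are rare.

    The geometry of pi enters through the proposal mass of level regions.
    Combining the two hypotheses on the gradient, the slope of ln pi tends to
    minus infinity along every direction in a cone around x / |x|, uniformly
    near x ([ln_density_decay_near]).  Hence stepping from x back towards the origin
    multiplies pi by an arbitrarily large factor on a box of fixed size
    ([superlevel_mass]).  The set of y near x with pi y comparable to pi x is
    disjoint from its translates by multiples of x / (N |x|), so that N copies
    of it fit in a bounded box; its volume, and then its proposal mass, is small
    ([near_level_mass]).  This packing argument uses only the translation
    invariance of Lebesgue measure. *)

(** * Translation invariance of Lebesgue measure on R^d *)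

Section translation.
Context {R : realType}.
Implicit Type d : nat.

Lemma measurable_rV_add d (v : 'rV[R]_d) :
  measurable_fun setT (fun x : 'rV[R]_d => x + v).
Proof.
apply: measurable_fun_rVP => i.
rewrite (_ : (fun _ => _) = (fun x : 'rV[R]_d => x ord0 i + v ord0 i)).
  by apply: measurable_funD => //; exact: measurable_coord.
by apply/funext => x; rewrite mxE.
Qed.

Lemma lebesgue_measure_add (c : R) (A : set (measurableTypeR R)) : measurable A ->
  lebesgue_measure ((fun x : R => x + c) @^-1` A) = lebesgue_measure A.
Proof.
have mc : measurable_fun setT
    ((fun x => x + c) : measurableTypeR R -> measurableTypeR R).
  exact: measurable_funD.
move=> mA; pose mu := measure_function_pushforward__canonical__measure_function_Measure
    (@lebesgue_measure R) mc.
rewrite [RHS](@lebesgue_measure_unique R mu)// => X [[a b] _ <-] /=.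
rewrite /pushforward/= (_ : _ @^-1` _ = `]a - c, b - c]%classic); last first.
  by apply/seteqP; split => x /=; rewrite !in_itv/= ltrBlDr lerBrDr.
by rewrite !lebesgue_measure_itv/= !lte_fin ltrD2r -!EFinB opprB addrA subrK.
Qed.

(** By induction on the dimension: a translated product measure agrees with the
    product measure on rectangles, and this determines it. *)
Lemma lebesgue_rV_add d (v : 'rV[R]_d) (A : set 'rV[R]_d) : measurable A ->
  lebesgue_rV d ((fun x => x + v) @^-1` A) = lebesgue_rV d A.
Proof.
elim: d v A => [|d IH] v A mA.
  congr (lebesgue_rV 0 _); apply/seteqP; split => x /=;
  by rewrite (_ : x + v = x)//; apply/rowP => -[].
pose v' : 'rV[R]_d := \row_i v ord0 (lift ord0 i).
pose sh (z : measurableTypeR R * 'rV[R]_d) : measurableTypeR R * 'rV[R]_d :=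
  (z.1 + v ord0 ord0, z.2 + v').
have msh : measurable_fun setT sh.
  apply/measurable_fun_pairP; split.
    by apply: measurable_funD => //; exact: measurable_fst.
  exact: (measurableT_comp (measurable_rV_add v')).
have mcA : measurable (cons_rV @^-1` A).
  by rewrite -[X in measurable X]setTI; exact: measurable_cons_rV.
pose mu := measure_function_pushforward__canonical__measure_function_Measure
    (lebesgue_measure \x lebesgue_rV d)%E msh.
rewrite /= /lebesgue_rV_step /pushforward/= [RHS](@product_measure_unique _ _ _ _ _ _ _ mu)//=.
  rewrite /pushforward; congr (product_measure1 _ _ _).
  apply/seteqP; split => -[t u] /=.
    rewrite (_ : cons_rV (t, u) + v = cons_rV (t + v ord0 ord0, u + v'))//.
    by apply/rowP => i; rewrite !mxE/=; case: unliftP => [j|] ->; rewrite /= ?mxE.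
  rewrite (_ : cons_rV (t, u) + v = cons_rV (t + v ord0 ord0, u + v'))//.
  by apply/rowP => i; rewrite !mxE/=; case: unliftP => [j|] ->; rewrite /= ?mxE.
move=> B C mB mC; rewrite /pushforward.
rewrite (_ : sh @^-1` _ = ((fun x => x + v ord0 ord0) @^-1` B) `*`
  ((fun x => x + v') @^-1` C)) ?product_measure1E//=.
- by rewrite IH// lebesgue_measure_add.
- by rewrite -[X in measurable X]setTI; apply: measurable_funD.
- by rewrite -[X in measurable X]setTI; apply: measurable_rV_add.
Qed.

Lemma ge0_integral_rV_add d (v : 'rV[R]_d) (f : 'rV[R]_d -> \bar R) :
  measurable_fun setT f -> (forall x, 0 <= f x)%E ->
  (\int[lebesgue_rV d]_x f (x + v)%R = \int[lebesgue_rV d]_x f x)%E.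
Proof.
move=> mf f0.
pose mu := measure_function_pushforward__canonical__measure_function_Measure
  (lebesgue_rV d) (measurable_rV_add v).
transitivity (\int[mu]_x f x)%E; last first.
  by apply: eq_measure_integral => A mA _; exact: lebesgue_rV_add.
rewrite (ge0_integral_pushforward (measurable_rV_add v))// ?preimage_setT//.
Qed.

End translation.

(** * Euclidean geometry *)

Section euclidean_geometry.
Context {R : realType} {d : nat}.
Implicit Types (x y z : 'rV[R]_d) (a : R).

Lemma dotrC x y : dotr x y = dotr y x.
Proof. by apply: eq_bigr => i _; rewrite mulrC. Qed.

Lemma dotrDl x y z : dotr (x + y) z = dotr x z + dotr y z.
Proof.
by rewrite /dotr -big_split/=; apply: eq_bigr => i _; rewrite mxE mulrDl.
Qed.

Lemma dotrZl a x y : dotr (a *: x) y = a * dotr x y.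
Proof. by rewrite /dotr mulr_sumr; apply: eq_bigr => i _; rewrite mxE mulrA. Qed.

Lemma dotrNl x y : dotr (- x) y = - dotr x y.
Proof. by rewrite -scaleN1r dotrZl mulN1r. Qed.

Lemma dotrBl x y z : dotr (x - y) z = dotr x z - dotr y z.
Proof. by rewrite dotrDl dotrNl. Qed.

Lemma dotrZr a x y : dotr x (a *: y) = a * dotr x y.
Proof. by rewrite dotrC dotrZl dotrC. Qed.

Lemma dotrBr x y z : dotr x (y - z) = dotr x y - dotr x z.
Proof. by rewrite dotrC dotrBl !(dotrC x). Qed.

Lemma dotrDr x y z : dotr x (y + z) = dotr x y + dotr x z.
Proof. by rewrite dotrC dotrDl !(dotrC x). Qed.

Lemma dotr_ge0 x : 0 <= dotr x x.
Proof. by apply: sumr_ge0 => i _; rewrite -expr2 sqr_ge0. Qed.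

Lemma enorm_ge0 x : 0 <= enorm x.
Proof. exact: sqrtr_ge0. Qed.

Lemma sqr_enorm x : enorm x ^+ 2 = dotr x x.
Proof. by rewrite sqr_sqrtr// dotr_ge0. Qed.

Lemma enormZ a x : enorm (a *: x) = `|a| * enorm x.
Proof.
by rewrite /enorm dotrZl dotrZr mulrA -expr2 sqrtrM ?sqr_ge0// sqrtr_sqr.
Qed.

Lemma enormN x : enorm (- x) = enorm x.
Proof. by rewrite -scaleN1r enormZ normrN normr1 mul1r. Qed.

Lemma enormBC x y : enorm (x - y) = enorm (y - x).
Proof. by rewrite -enormN opprB. Qed.

Lemma coord_le_enorm x i : `|x ord0 i| <= enorm x.
Proof.
rewrite -sqrtr_sqr ler_sqrt ?dotr_ge0// /dotr (bigD1 i)//= expr2 lerDl.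
by apply: sumr_ge0 => j _; rewrite -expr2 sqr_ge0.
Qed.

Lemma enorm0_eq0 x : enorm x = 0 -> x = 0.
Proof.
move=> x0; apply/rowP => i; rewrite mxE; apply/eqP.
by rewrite -normr_le0 -x0 coord_le_enorm.
Qed.

Lemma dotr0l y : dotr 0 y = 0.
Proof. by rewrite -(scale0r y) dotrZl mul0r. Qed.

(** Cauchy-Schwarz, from the positivity of the square norm of |y| x - |x| y. *)
Lemma dotr_le_enorm x y : dotr x y <= enorm x * enorm y.
Proof.
have [x0|x0] := eqVneq (enorm x) 0.
  by rewrite x0 (enorm0_eq0 x0) dotr0l mul0r.
have [y0|y0] := eqVneq (enorm y) 0.
  by rewrite y0 (enorm0_eq0 y0) dotrC dotr0l mulr0.
have xy0 : 0 < enorm x * enorm y by rewrite mulr_gt0// lt_def enorm_ge0 ?x0 ?y0.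
have := dotr_ge0 (enorm y *: x - enorm x *: y).
rewrite !(dotrBl, dotrBr, dotrZl, dotrZr) (dotrC y x) -!sqr_enorm => h.
have {h} : 0 <= 2 * (enorm x * enorm y) * (enorm x * enorm y - dotr x y).
  by apply: le_trans h _; rewrite le_eqVlt; apply/orP; left; apply/eqP; ring.
have ab0 : 0 < 2 * (enorm x * enorm y) by rewrite mulr_gt0.
by rewrite (pmulr_rge0 _ ab0) subr_ge0.
Qed.

Lemma enormD x y : enorm (x + y) <= enorm x + enorm y.
Proof.
rewrite -(@ler_pXn2r _ 2)// ?nnegrE ?addr_ge0 ?enorm_ge0//.
rewrite sqr_enorm !(dotrDl, dotrDr) (dotrC y x) -!sqr_enorm.
have := dotr_le_enorm x y; rewrite sqrrD; lra.
Qed.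

Lemma enormB_ge x y : enorm x - enorm y <= enorm (x - y).
Proof. by rewrite lerBlDr -[leLHS](_ : enorm (x - y + y) = _) ?enormD ?subrK. Qed.

Lemma enorm_le_sum x : enorm x <= \sum_i `|x ord0 i|.
Proof.
rewrite -(@ler_pXn2r _ 2)// ?nnegrE ?enorm_ge0 ?sumr_ge0//.
rewrite sqr_enorm /dotr expr2 mulr_suml; apply: ler_sum => i _.
rewrite -expr2 -real_normK ?num_real// expr2.
rewrite ler_wpM2l// (bigD1 i)//= lerDl; exact: sumr_ge0.
Qed.

(** Boxes, whose volume is explicit, serve in place of Euclidean balls. *)
Lemma enorm_le_box x a : (forall i, `|x ord0 i| <= a) -> enorm x <= d%:R * a.
Proof.
move=> xa; apply: le_trans (enorm_le_sum x) _.
apply: (@le_trans _ _ (\sum_(i < d) a)); first by apply: ler_sum => i _.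
by rewrite sumr_const card_ord mulr_natl.
Qed.

Lemma enorm_unitv x : 0 < enorm x -> enorm (unitv x) = 1.
Proof.
by move=> x0; rewrite enormZ normfV ger0_norm ?enorm_ge0// mulVf// gt_eqF.
Qed.

Lemma unitvK x : enorm x *: unitv x = x.
Proof.
rewrite scalerA; have [x0|x0] := eqVneq (enorm x) 0.
  by rewrite (enorm0_eq0 x0) scaler0.
by rewrite divff// scale1r.
Qed.

Lemma unitvZ a x : 0 < a -> unitv (a *: x) = unitv x.
Proof.
move=> a0; rewrite /unitv enormZ gtr0_norm// scalerA invfM.
by rewrite mulrAC mulVf ?gt_eqF// mul1r.
Qed.

(** Far from the origin the radial direction is almost constant on bounded sets. *)
Lemma unitv_close x y : 0 < enorm x -> 0 < enorm y ->
  enorm (unitv y - unitv x) <= 2 * enorm (y - x) / enorm x.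
Proof.
move=> x0 y0.
have -> : unitv y - unitv x =
    (enorm x)^-1 *: (y - x) + ((enorm y)^-1 - (enorm x)^-1) *: y.
  by rewrite /unitv scalerBr scalerBl [RHS]addrC [RHS]addrA subrK.
apply: le_trans (enormD _ _) _; rewrite !enormZ.
have -> : (enorm y)^-1 - (enorm x)^-1 = (enorm x - enorm y) / (enorm x * enorm y).
  by field; rewrite !gt_eqF.
have -> : `|(enorm x - enorm y) / (enorm x * enorm y)| =
    `|enorm x - enorm y| / (enorm x * enorm y).
  by rewrite normrM [X in _ * X]gtr0_norm// invr_gt0 mulr_gt0.
have -> : `|(enorm x)^-1| = (enorm x)^-1 by rewrite gtr0_norm ?invr_gt0.
have -> : `|enorm x - enorm y| / (enorm x * enorm y) * enorm y =
    `|enorm x - enorm y| / enorm x by field; rewrite !gt_eqF.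
have xy : `|enorm x - enorm y| <= enorm (y - x).
  have h1 := enormB_ge x y; have h2 := enormB_ge y x.
  rewrite enormBC in h1; rewrite ler_norml; apply/andP; split; lra.
rewrite mulrC -mulrDl ler_wpM2r ?invr_ge0 ?enorm_ge0//; lra.
Qed.

End euclidean_geometry.

(** * Slope of the log-density far from the origin *)

Section slopes.
Context {R : realType} {d : nat}.
Implicit Types (x y v : 'rV[R]_d).

Lemma derive_gradient (f : 'rV[R]_d -> R) x v : differentiable f x ->
  'D_v f x = dotr v (gradient f x).
Proof.
move=> df; rewrite deriveE// [in LHS](row_sum_delta v) linear_sum.
by apply: eq_bigr => i _; rewrite linearZ/= mxE deriveE.
Qed.

(** The difference quotients along the line are those of the directional
    derivative. *)
Lemma is_derive_line (f : 'rV[R]_d -> R) y v (t : R) :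
  differentiable f (y + t *: v) ->
  is_derive t 1 (fun t : R => f (y + t *: v)) (dotr v (gradient f (y + t *: v))).
Proof.
move=> df.
have E : (fun h : R => h^-1 *: (f (y + (h *: 1 + t : R) *: v) - f (y + t *: v))) =
    (fun h => h^-1 *: (f (h *: v + (y + t *: v)) - f (y + t *: v))).
  apply/funext => h; congr (_ *: (f _ - _)).
  by rewrite [h *: 1]mulr1 scalerDl addrCA.
have dv : derivable f (y + t *: v) v by exact: diff_derivable.
apply: DeriveDef.
  by move: dv; rewrite /derivable; rewrite -E.
by rewrite -derive_gradient// /derive -E.
Qed.

Lemma line_decay (f : 'rV[R]_d -> R) y v (L T : R) :
  (forall x, differentiable f x) -> 0 <= T ->
  (forall t, 0 <= t <= T -> dotr v (gradient f (y + t *: v)) <= - L) ->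
  f (y + T *: v) <= f y - L * T.
Proof.
move=> df; rewrite le_eqVlt => /predU1P[<- _|T0 fL].
  by rewrite scale0r addr0 mulr0 subr0.
pose g t := f (y + t *: v).
have dg (t : R) : is_derive t 1 g (dotr v (gradient f (y + t *: v))).
  exact: is_derive_line.
have cg : {within `[0, T], continuous g}.
  by apply: derivable_within_continuous => t _; exact: ex_derive.
have [c] := MVT T0 (fun t _ => dg t) cg.
rewrite in_itv/= => /andP[c0 cT]; rewrite /g scale0r addr0 subr0 => fE.
have := fL c; rewrite (ltW c0) (ltW cT) => /(_ isT) h.
have := ler_wpM2r (ltW T0) h; rewrite -fE; lra.
Qed.

End slopes.

Section tails.
Context {R : realType} {d : nat}.
Variable pi : 'rV[R]_d -> R.
Implicit Types (x y v : 'rV[R]_d).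
Hypothesis pi_gt0 : forall x, 0 < pi x.
Hypothesis pi_C1 : C1 pi.
Hypothesis pi_tail : dotr (unitv x) (gradient (fun y => ln (pi y)) x)
                 @[x --> infty_nbhs] --> -oo.
Hypothesis pi_contour :
       (limf_esup (fun x => (dotr (unitv x) (unitv (gradient pi x)))%:E)
          infty_nbhs < 0)%E.

Local Notation lpi := (fun y => ln (pi y)).

Lemma differentiable_ln_density x : differentiable lpi x.
Proof.
have -> : lpi = @ln R \o pi by [].
apply: differentiable_comp; first by case: pi_C1.
by apply/derivable1_diffP; apply: ex_derive; exact: is_derive1_ln.
Qed.

Lemma gradient_ln_density x : gradient lpi x = (pi x)^-1 *: gradient pi x.
Proof.
apply/rowP => i; rewrite !mxE.
have dpi : differentiable pi x by case: pi_C1.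
have dln : is_derive (pi x) 1 (@ln R) (pi x)^-1 by exact: is_derive1_ln.
have dln' : differentiable (@ln R) (pi x).
  by apply/derivable1_diffP; exact: ex_derive.
have -> : lpi = @ln R \o pi by [].
rewrite !deriveE//; last exact: differentiable_comp.
rewrite diff_comp//=.
by rewrite diff1E//= derive1E derive_val mulrC.
Qed.

Lemma radial_slope_le (A : R) : exists r : R, forall x, r < enorm x ->
  dotr (unitv x) (gradient lpi x) <= A.
Proof.
have [r _ rA] := pi_tail (nbhs_ninfty_le (num_real A)).
by exists r => x /rA.
Qed.

Lemma radial_gradient_angle : exists2 c : R, 0 < c & exists r : R, forall x, r < enorm x ->
  dotr (unitv x) (unitv (gradient pi x)) <= - c.
Proof.
move: pi_contour; rewrite limf_esupE => /ereal_inf_lt[_ [V [r _ rV] <-]] sup0.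
set S := ereal_sup _ in sup0.
have SV x : r < enorm x -> ((dotr (unitv x) (unitv (gradient pi x)))%:E <= S)%E.
  by move=> rx; apply: ereal_sup_ubound; exists x => //; exact: rV.
case: S sup0 SV => [s|//|] s0 SV.
  exists (- s); first by rewrite oppr_gt0.
  by exists r => x /SV; rewrite lee_fin opprK.
by exists 1 => //; exists r => x /SV; rewrite leeNy_eq.
Qed.

(** Write the gradient of ln pi at y as N m with m a unit vector and N its norm.
    The contour condition bounds the inner product of m with y / |y| away from
    zero, so it stays negative for v close to y / |y|; the tail condition forces
    N to infinity. *)
Lemma cone_slope_le : exists2 c : R, 0 < c <= 1 & forall L : R, 0 <= L ->
  exists2 r : R, 0 < r & forall y, r < enorm y -> forall v, enorm (v - unitv y) <= c ->
    dotr v (gradient lpi y) <= - L.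
Proof.
have [c c0 [r1 r1P]] := radial_gradient_angle.
have c20 : 0 < c / 2 by rewrite divr_gt0.
exists (Num.min 1 (c / 2)); first by rewrite lt_min ltr01 c20 ge_min lexx.
move=> L L0; have [r2 r2P] := radial_slope_le (- (L / (c / 2) + 1)).
exists (Num.max 1 (Num.max r1 r2)); first by rewrite lt_max ltr01.
move=> y; rewrite !gt_max => /and3P[y1 yr1 yr2] v; rewrite le_min => /andP[_ vc].
have y0 : 0 < enorm y by apply: lt_trans y1.
set n := unitv y in vc *; have n1 : enorm n = 1 by exact: enorm_unitv.
set G := gradient pi y; set m := unitv G.
have Lc : 0 <= L / (c / 2) by rewrite divr_ge0// ltW.
have nm : dotr n m <= - c := r1P _ yr1.
have gE : gradient lpi y = (enorm G / pi y) *: m.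
  by rewrite gradient_ln_density -/G -{1}(unitvK G) scalerA mulrC.
have ng := r2P _ yr2; rewrite gE dotrZr -/n in ng.
set N := enorm G / pi y in ng gE.
have N0 : 0 <= N by rewrite divr_ge0 ?enorm_ge0// ltW.
have G0 : 0 < enorm G.
  rewrite lt_def enorm_ge0 andbT; apply/eqP => G0.
  by move: ng; rewrite /N G0 mul0r mul0r; lra.
have m1 : enorm m = 1 by exact: enorm_unitv.
have nm1 : - 1 <= dotr n m.
  rewrite lerNl -dotrNl; apply: le_trans (dotr_le_enorm _ _) _.
  by rewrite enormN n1 m1 mulr1.
have NL : L / (c / 2) <= N.
  have : N * -1 <= N * dotr n m by rewrite ler_wpM2l.
  lra.
have vm : dotr v m <= - (c / 2).
  have -> : v = n + (v - n) by rewrite addrC subrK.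
  rewrite dotrDl.
  have : dotr (v - n) m <= c / 2.
    by apply: le_trans (dotr_le_enorm _ _) _; rewrite m1 mulr1.
  lra.
rewrite gE dotrZr; move: NL; rewrite ler_pdivrMr// => NL.
have : N * dotr v m <= N * - (c / 2) by rewrite ler_wpM2l.
lra.
Qed.

(** The direction y / |y| in [cone_slope_le] is replaced by x / |x| for all y
    near x, so that one direction v can be followed along a whole segment. *)
Lemma ln_density_decay_near : exists2 c : R, 0 < c <= 1 & forall L D : R, 0 <= L -> 0 <= D ->
  exists2 r : R, 0 < r & forall x, r < enorm x ->
    forall y v (T : R), enorm (y - x) <= D -> enorm (v - unitv x) <= c ->
      0 <= T <= 1 -> ln (pi (y + T *: v)) <= ln (pi y) - L * T.
Proof.
have [c /andP[c0 c1] cP] := cone_slope_le.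
have c20 : 0 < c / 2 by rewrite divr_gt0.
exists (c / 2); first by rewrite c20/=; lra.
move=> L D L0 D0; have [r0 r00 r0P] := cP L L0.
pose E := D + 2.
have E0 : 0 < E by rewrite /E; lra.
have Ec0 : 0 < 2 * E / (c / 2) by rewrite divr_gt0// mulr_gt0.
exists (r0 + E + 2 * E / (c / 2)); first by apply: addr_gt0 => //; exact: addr_gt0.
move=> x rx y v T yx vx /andP[T0 T1].
have x0 : 0 < enorm x by apply: lt_trans rx; apply: addr_gt0 => //; exact: addr_gt0.
have v2 : enorm v <= 2.
  have -> : v = (v - unitv x) + unitv x by rewrite subrK.
  apply: le_trans (enormD _ _) _; rewrite enorm_unitv//; lra.
apply: (@line_decay _ _ lpi) => //; first exact: differentiable_ln_density.
move=> t /andP[t0 tT]; set z := y + t *: v.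
have zx : enorm (z - x) <= E.
  have -> : z - x = (y - x) + t *: v by rewrite /z addrAC.
  apply: le_trans (enormD _ _) _; rewrite enormZ ger0_norm// /E lerD//.
  have t1 : t <= 1 by apply: le_trans T1.
  by rewrite -[leRHS]mul1r ler_pM// enorm_ge0.
have zr : r0 < enorm z.
  have := enormB_ge x z; rewrite enormBC; lra.
apply: r0P => //.
have -> : v - unitv z = (v - unitv x) - (unitv z - unitv x).
  by rewrite opprB addrA subrK.
apply: le_trans (enormD _ _) _; rewrite enormN.
have z0 : 0 < enorm z by apply: lt_trans zr.
have := unitv_close x0 z0.
have : 2 * enorm (z - x) / enorm x <= c / 2.
  rewrite ler_pdivrMr// [leRHS]mulrC -ler_pdivrMr//.
  apply: (@le_trans _ _ (2 * E / (c / 2))); last first.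
    by apply/ltW; apply: le_lt_trans rx; rewrite lerDr addr_ge0// ltW.
  by rewrite ler_pM2r ?invr_gt0// ler_pM2l.
lra.
Qed.

Lemma continuous_density : continuous pi.
Proof. by move=> x; apply: differentiable_continuous; case: pi_C1. Qed.

Lemma continuous_bounded_box (f : 'rV[R]_d -> R) (a : R) : continuous f ->
  exists B : R, forall x, (forall i, `|x ord0 i| <= a) -> f x <= B.
Proof.
move=> cf; set A := [set x : 'rV[R]_d | forall i, `[- a, a]%classic (x ord0 i)].
have cA : compact A.
  by apply: (@rV_compact R d (fun=> `[- a, a]%classic)) => i; exact: segment_compact.
have /compact_bounded[B [_ BP]] : compact (f @` A).
  by apply: continuous_compact => //; exact: continuous_subspaceT.
exists (B + 1) => x xa; apply: le_trans (ler_norm _) _.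
apply: (BP (B + 1)); first by rewrite ltrDl.
by exists x => // i /=; rewrite in_itv/= -ler_norml.
Qed.

(** Beyond some radius pi decreases along rays, so its values are dominated by
    those on a compact set. *)
Lemma pi_bounded : exists2 B : R, 0 < B & forall x, pi x <= B.
Proof.
have [c /andP[c0 _] /(_ 0 (lexx _))[r r0 rP]] := cone_slope_le.
have [B BP] := continuous_bounded_box (r + 1) continuous_density.
have near0 x : enorm x <= r + 1 -> pi x <= B.
  by move=> xr; apply: BP => i; apply: le_trans (coord_le_enorm _ _) xr.
have B0 : 0 < B.
  apply: lt_le_trans (near0 0 _); first exact: pi_gt0.
  by rewrite -(scale0r (0 : 'rV[R]_d)) enormZ normr0 mul0r; lra.
exists B => // x.
have [|xr] := leP (enorm x) (r + 1); first exact: near0.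
have x0 : 0 < enorm x by apply: lt_trans xr; lra.
set n := unitv x; have n1 : enorm n = 1 by exact: enorm_unitv.
have rn : enorm ((r + 1) *: n) = r + 1.
  by rewrite enormZ n1 mulr1 ger0_norm//; lra.
have : pi ((r + 1) *: n) <= B by apply: near0; rewrite rn.
apply: le_trans; rewrite -ler_ln ?posrE//.
have T0 : 0 <= enorm x - (r + 1) by lra.
have := @line_decay _ _ lpi ((r + 1) *: n) n 0 _ differentiable_ln_density T0.
rewrite mul0r subr0 -scalerDl [_ + (_ - _)]addrC subrK unitvK; apply.
move=> t /andP[t0 _]; rewrite -scalerDl.
have rt0 : 0 < r + 1 + t by lra.
apply: rP.
  by rewrite enormZ n1 mulr1 ger0_norm; lra.
have -> : unitv ((r + 1 + t) *: n) = n.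
  by rewrite unitvZ// /unitv n1 invr1 scale1r.
by rewrite subrr -(scale0r (0 : 'rV[R]_d)) enormZ normr0 mul0r ltW.
Qed.

End tails.

(** * Proposal mass of level regions of the target *)

Section boxes.
Context {R : realType} {d : nat}.
Implicit Types (a x y v : 'rV[R]_d) (r : R).

Definition box a r := [set y : 'rV[R]_d | forall i, `|y ord0 i - a ord0 i| <= r].

Lemma boxE a r : box a r =
  [set y | forall i, (`[a ord0 i - r, a ord0 i + r]%classic : set (measurableTypeR R)) (y ord0 i)].
Proof.
by apply/seteqP; split => y yi i; have := yi i; rewrite /= in_itv/= ler_distl.
Qed.

Lemma measurable_coordinatewise (A : 'I_d -> set (measurableTypeR R)) :
  (forall i, measurable (A i)) ->
  measurable [set x : 'rV[R]_d | forall i, A i (x ord0 i)].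
Proof.
move=> mA; rewrite (_ : mkset _ = \big[setI/setT]_(i < d)
    ((fun x : 'rV[R]_d => x ord0 i) @^-1` A i)).
  apply: bigsetI_measurable => i _; rewrite -[X in measurable X]setTI.
  by apply: (measurable_coord i); [exact: measurableT|exact: mA].
rewrite -bigcap_seq; apply/seteqP; split => x /= h i.
  by move=> _; exact: h.
by apply: h; exact: mem_index_enum.
Qed.

Lemma measurable_box a r : measurable (box a r).
Proof.
rewrite boxE; apply: (@measurable_coordinatewise (fun i =>
  `[a ord0 i - r, a ord0 i + r]%classic)) => i.
exact: measurable_itv.
Qed.

Lemma lebesgue_box a r : 0 < r -> lebesgue_rV d (box a r) = ((2 * r) ^+ d)%:E.
Proof.
move=> r0; rewrite boxE (@lebesgue_rV_box R d (fun i =>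
  `[a ord0 i - r, a ord0 i + r]%classic)); last by move=> i; exact: measurable_itv.
rewrite (eq_bigr (fun=> (2 * r)%:E)); last first.
  move=> i _; rewrite lebesgue_measure_itv/= lte_fin ifT; last by lra.
  by rewrite -EFinB; congr EFin; lra.
by rewrite prodEFin prodr_const card_ord.
Qed.

End boxes.

(** The union of the sets A k lies in B, and disjointness gives it measure N m. *)
Lemma packing_bound d (T : measurableType d) (R : realType)
    (mu : {measure set T -> \bar R}) (N : nat) (A : nat -> set T) (B : set T)
    (m : \bar R) : measurable B ->
  (forall k, (k < N)%N -> measurable (A k) /\ A k `<=` B /\ mu (A k) = m) ->
  (forall j k y, (j < k)%N -> (k < N)%N -> A j y -> A k y -> False) ->
  (N%:R%:E * m <= mu B)%E.
Proof.
move=> mB AP disj.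
have mA k : `I_N k -> measurable (A k) by move=> /AP[].
have triv : trivIset `I_N A.
  move=> j k jN kN [y [Ajy Aky]].
  case: (ltngtP j k) => // jk; exfalso.
    exact: (disj j k y).
  exact: (disj k j y).
have fN : finite_set `I_N by exact: finite_II.
have := measure_fin_bigcup mu fN triv mA.
rewrite (eq_fsbigr (fun=> m)); last by move=> k /[!inE] /AP[_ []].
have -> : (\sum_(i \in `I_N) m = N%:R%:E * m)%E.
  rewrite -[LHS](@fsbig_ord _ _ +%E N (fun=> m))/= sumr_const card_ord.
  by rewrite mule_natl.
move=> <-; apply: le_measure; rewrite ?inE//.
  exact: fin_bigcup_measurable.
by move=> y [k /AP[_ [AB _]]]; exact: AB.
Qed.

Section proposal_mass.
Context {R : realType} {d : nat}.
Variables (pi q : 'rV[R]_d -> R).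
Implicit Types (x y v : 'rV[R]_d).
Hypothesis pi_gt0 : forall x, 0 < pi x.
Hypothesis mpi : measurable_fun setT pi.
Hypothesis pi_C1 : C1 pi.
Hypothesis pi_tail : dotr (unitv x) (gradient (fun y => ln (pi y)) x)
                 @[x --> infty_nbhs] --> -oo.
Hypothesis pi_contour :
       (limf_esup (fun x => (dotr (unitv x) (unitv (gradient pi x)))%:E)
          infty_nbhs < 0)%E.
Hypothesis q_density : probability_density q.
Hypothesis q_near0 : exists2 e : R, 0 < e & \forall z \near (0 : 'rV[R]_d), e <= q z.

Let mq : measurable_fun setT q. Proof. by case: q_density. Qed.
Let q0 v : 0 <= q v. Proof. by case: q_density. Qed.

Definition superlevel (k : R) x := [set y | k * pi x <= pi y].

Definition near_level (k : R) x := [set y | pi y <= k * pi x /\ pi x <= k * pi y].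

Lemma measurable_superlevel k x : measurable (superlevel k x).
Proof.
rewrite (_ : superlevel k x = pi @^-1` `[k * pi x, +oo[).
  by rewrite -[X in measurable X]setTI; apply: mpi.
by apply/seteqP; split => y /=; rewrite in_itv/= andbT.
Qed.

Lemma measurable_near_level k x : 0 < k -> measurable (near_level k x).
Proof.
move=> k0; rewrite (_ : near_level k x = pi @^-1` `[pi x / k, k * pi x]).
  by rewrite -[X in measurable X]setTI; apply: mpi.
apply/seteqP; split => y /=; rewrite in_itv/=.
  by move=> [h1 h2]; apply/andP; split => //; rewrite ler_pdivrMr// mulrC.
by move=> /andP[h1 h2]; split => //; rewrite mulrC -ler_pdivrMr.
Qed.

Let mqx x : measurable_fun setT (fun y : 'rV[R]_d => q (y - x)).
Proof. exact: (measurableT_comp mq (measurable_rV_add (- x))). Qed.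

(** The density q is bounded below near the origin, so a region of proposals
    has at least the mass of any small box close to x that it contains. *)
Lemma small_box_mass : exists2 t : R, 0 < t & exists2 e : R, 0 < e &
  forall x a r (D : set 'rV[R]_d), 0 < r -> measurable D ->
    box a r `<=` box x t -> box a r `<=` D ->
    ((e * (2 * r) ^+ d)%:E <= \int[lebesgue_rV d]_y (q (y - x)%R * \1_D y)%:E)%E.
Proof.
have [e e0 /nbhs_ballP[t /= t0 tP]] := q_near0.
exists (t / 2); first by rewrite divr_gt0.
exists e => // x a r D r0 mD ax aD.
rewrite EFinM -(lebesgue_box a r0).
rewrite -[X in (_ * lebesgue_rV d X)%E](setIT (box a r)).
rewrite -(integral_indic _ measurableT (measurable_box a r)).
rewrite -ge0_integralZl//; last 2 first.
- by apply/measurable_EFinP; exact: measurable_indic (measurable_box a r).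
- by rewrite lee_fin ltW.
apply: ge0_le_integral => //.
- by move=> y _; rewrite -EFinM lee_fin mulr_ge0// ltW.
- apply/measurable_EFinP; apply: measurable_funM => //.
  exact: measurable_indic (measurable_box a r).
- by apply/measurable_EFinP; apply: measurable_funM => //; exact: measurable_indic.
move=> y _; rewrite -EFinM lee_fin !indicE.
have [ay|_] := boolP (y \in box a r); last by rewrite mulr0 mulr_ge0.
rewrite mem_set ?mulr1; last by apply: aD; rewrite -in_setE.
apply: tP; split=> // i j; rewrite (ord1 i) !mxE /ball/= sub0r normrN.
have /ax/(_ j) : box a r y by rewrite -in_setE.
by move=> /le_lt_trans; apply; lra.
Qed.

(** One constant m serves for all regions.  Far out, the region contains a box
    around x - tau x / |x| whose points reach x by a step of length of order tau
    in a direction along which ln pi falls steeply; near the origin, continuity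
    and positivity of pi bound pi y / pi x from below by some kappa. *)
Lemma superlevel_mass : exists2 m : R, 0 < m &
  (forall K, 1 <= K -> exists2 r : R, 0 < r & forall x, r < enorm x ->
    (m%:E <= \int[lebesgue_rV d]_y (q (y - x)%R * \1_(superlevel K x) y)%:E)%E) /\
  exists2 kappa : R, 0 < kappa <= 1 & forall x,
    (m%:E <= \int[lebesgue_rV d]_y (q (y - x)%R * \1_(superlevel kappa x) y)%:E)%E.
Proof.
have [t t0 [e e0 massP]] := small_box_mass.
have [c /andP[c0 c1] decP] := ln_density_decay_near pi_gt0 pi_C1 pi_tail pi_contour.
pose tau := Num.min 1 (t / 3).
have tau0 : 0 < tau by rewrite lt_min ltr01 divr_gt0.
have tau1 : tau <= 1 by rewrite ge_min lexx.
have taut : tau <= t / 3 by rewrite ge_min lexx orbT.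
(* A box of radius rho lies in the Euclidean ball of radius tau c; the divisor is
   d + 1 to remain positive in dimension 0. *)
pose rho := tau * c / d.+1%:R.
have rho0 : 0 < rho by rewrite divr_gt0// mulr_gt0.
have drho : d%:R * rho <= tau * c.
  rewrite /rho mulrCA ler_piMr ?mulr_ge0 ?(ltW tau0) ?(ltW c0)//.
  by rewrite ler_pdivrMr// mul1r ler_nat.
have rhot : rho <= t.
  apply: (@le_trans _ _ (tau * c)).
    by rewrite ler_piMr ?mulr_ge0 ?(ltW tau0) ?(ltW c0)// invf_le1 ?ler1n ?ltr0n.
  apply: (@le_trans _ _ tau); first by rewrite ler_piMr// ltW.
  lra.
have far K : 1 <= K -> exists2 r : R, 0 < r & forall x, r < enorm x ->
    ((e * (2 * rho) ^+ d)%:E <=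
     \int[lebesgue_rV d]_y (q (y - x)%R * \1_(superlevel K x) y)%:E)%E.
  move=> K1; have lnK : 0 <= ln K by rewrite ln_ge0.
  have L0 : 0 <= ln K / tau by rewrite divr_ge0// ltW.
  have [r r0 rP] := decP _ 2 L0 (ler0n _ _).
  exists r => // x rx; set n := unitv x.
  have x0 : 0 < enorm x by apply: lt_trans rx.
  have n1 : enorm n = 1 by exact: enorm_unitv.
  have dirP y : box (x - tau *: n) rho y ->
      exists v, [/\ x = y + tau *: v, enorm (v - n) <= c & enorm v <= 2].
    move=> yb; pose v := tau^-1 *: (x - y); exists v.
    have vn : enorm (v - n) <= c.
      have -> : v - n = tau^-1 *: ((x - tau *: n) - y).
        rewrite /v -[in RHS]addrAC [RHS]scalerBr scalerA mulVf ?gt_eqF// scale1r.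
        by [].
      rewrite enormZ gtr0_norm ?invr_gt0// mulrC ler_pdivrMr//.
      rewrite enormBC mulrC; apply: le_trans drho; apply: enorm_le_box => i.
      by have := yb i; rewrite !mxE.
    split => //.
      by rewrite /v scalerA mulfV ?gt_eqF// scale1r addrC subrK.
    rewrite -[v](subrK n); apply: le_trans (enormD _ _) _; rewrite n1; lra.
  apply: (massP _ (x - tau *: n)) => //; first exact: measurable_superlevel.
    move=> y /dirP[v [xE _ v2]] i.
    have -> : y ord0 i - x ord0 i = - (tau * v ord0 i) by rewrite xE !mxE; ring.
    rewrite normrN normrM gtr0_norm//.
    apply: (@le_trans _ _ (t / 3 * 2)); last by lra.
    by rewrite ler_pM ?(ltW tau0)// (le_trans (coord_le_enorm _ _)).
  move=> y /dirP[v [xE vn v2]]; rewrite /superlevel/=.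
  have yx2 : enorm (y - x) <= 2.
    rewrite [in X in _ - X]xE opprD addNKr enormN enormZ gtr0_norm//.
    by rewrite -[leRHS]mul1r ler_pM ?enorm_ge0// ltW.
  have T01 : 0 <= tau <= 1 by rewrite ltW.
  have := rP x rx y v tau yx2 vn T01.
  rewrite -xE divfK ?gt_eqF// => h.
  rewrite -ler_ln ?posrE ?mulr_gt0//; last exact: lt_le_trans K1.
  by rewrite lnM ?posrE//; [lra|exact: lt_le_trans K1].
exists (e * (2 * rho) ^+ d); first by rewrite mulr_gt0// exprn_gt0// mulr_gt0.
split => //.
have [r r0 rP] := far 1 (lexx _).
have [B B0 BP] := pi_bounded pi_gt0 pi_C1 pi_tail pi_contour.
have cV : continuous (fun x => (pi x)^-1).
  move=> x; have pix : pi x != 0 by rewrite gt_eqF.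
  exact: (cvgV pix (continuous_density pi_C1 (x := x))).
have [B' B'P] := continuous_bounded_box (r + t) cV.
have B'0 : 0 < B'.
  apply: lt_le_trans (B'P 0 _); first by rewrite invr_gt0.
  by move=> i; rewrite mxE normr0 addr_ge0// ltW.
pose kappa := Num.min 1 (B'^-1 / B).
have kappa0 : 0 < kappa by rewrite lt_min ltr01 divr_gt0// invr_gt0.
exists kappa; first by rewrite kappa0 ge_min lexx.
move=> x; have [xr|rx] := leP (enorm x) r; last first.
  apply: (le_trans (rP x rx)); apply: ge0_le_integral => //.
  - by move=> y _; rewrite lee_fin mulr_ge0.
  - apply/measurable_EFinP; apply: measurable_funM => //.
    by apply: measurable_indic; exact: measurable_superlevel.
  - apply/measurable_EFinP; apply: measurable_funM => //.
    by apply: measurable_indic; exact: measurable_superlevel.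
  move=> y _; rewrite lee_fin ler_wpM2l// !indicE ler_nat.
  case: (boolP (y \in superlevel 1 x)) => //; rewrite inE /superlevel/= => h.
  rewrite mem_set//=; apply: le_trans h; rewrite ler_wpM2r ?(ltW (pi_gt0 x))//.
  by rewrite ge_min lexx.
apply: (massP x x) => //; first exact: measurable_superlevel.
  by move=> y yx i; apply: le_trans (yx i) _.
move=> y yx; rewrite /superlevel/=.
have yB' : (pi y)^-1 <= B'.
  apply: B'P => i; rewrite -[y ord0 i](subrK (x ord0 i)) addrC.
  apply: le_trans (ler_normD _ _) _; apply: lerD.
    by apply: le_trans (coord_le_enorm _ _) xr.
  exact: le_trans (yx i) rhot.
apply: (@le_trans _ _ (B'^-1 / B * B)).
  rewrite ler_pM ?(ltW kappa0) ?(ltW (pi_gt0 x))// ge_min lexx orbT//.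
rewrite mulfVK ?gt_eqF// -[leRHS]invrK lef_pV2// posrE invr_gt0//.
Qed.

(** A proposal density is bounded and boundedly supported up to an arbitrarily
    small mass: it is at most n on a box of radius n, and the complement of
    the sets where this holds shrinks to the empty set. *)
Lemma proposal_tail (eps : R) : 0 < eps -> exists n : nat, forall A : set 'rV[R]_d,
  measurable A ->
  (\int[lebesgue_rV d]_z (q z * \1_A z)%:E
    <= n%:R%:E * lebesgue_rV d (box 0 n%:R `&` A) + eps%:E)%E.
Proof.
move=> eps0; pose F (n : nat) := box 0 n%:R `&` [set z | q z <= n%:R].
have mF n : measurable (F n).
  apply: measurableI; first exact: measurable_box.
  rewrite (_ : [set z | _] = q @^-1` `]-oo, n%:R]).
    by rewrite -[X in measurable X]setTI; apply: mq.
  by apply/seteqP; split => y /=; rewrite in_itv.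
have ndF : {homo F : n m / (n <= m)%N >-> (n <= m)%O}.
  move=> n m nm; apply/subsetPset => z [zn qn].
  have nmR : n%:R <= m%:R :> R by rewrite ler_nat.
  by split; [move=> i; apply: le_trans (zn i) nmR|exact: le_trans nmR].
have FT : \bigcup_n F n = setT.
  rewrite -subTset => z _.
  have ez0 : 0 <= enorm z + q z by rewrite addr_ge0// enorm_ge0.
  have zn := ltW (archi_boundP ez0).
  exists (Num.bound (enorm z + q z)) => //; split.
    move=> i; rewrite mxE subr0; apply: le_trans zn.
    by apply: (le_trans (coord_le_enorm z i)); rewrite lerDl.
  by apply: le_trans zn; rewrite lerDr enorm_ge0.
have mqE D : measurable_fun D (fun z => (q z)%:E).
  by apply/measurable_EFinP; exact: (measurable_funS measurableT).
have qE0 z : (0 <= (q z)%:E)%E by rewrite lee_fin.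
have cvgF := @ge0_nondecreasing_set_cvg_integral _ _ _ F (fun z => (q z)%:E)
  (lebesgue_rV d) ndF mF (fun n => mqE (F n)) (fun n z _ => qE0 z).
have q1 : (\int[lebesgue_rV d]_z (q z)%:E = 1)%E by case: q_density.
rewrite FT q1 in cvgF.
have nb1 : nbhs (1%E : \bar R) [set y : \bar R | ((1 - eps)%:E < y)%E].
  apply: open_nbhs_nbhs; split; first exact: open_ereal_gt_ereal.
  by rewrite /= lte_fin ltrBlDr ltrDl.
have [n _ /(_ n (leqnn n)) /= Fn] := cvgF _ nb1.
exists n => A mA.
have qU : (\int[lebesgue_rV d]_(z in F n) (q z)%:E
    + \int[lebesgue_rV d]_(z in ~` F n) (q z)%:E = 1)%E.
  rewrite -q1 -(setUv (F n)) ge0_integral_setU//.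
  - exact: measurableC.
  - exact/disj_setPCl.
have qC : (\int[lebesgue_rV d]_(z in ~` F n) (q z)%:E <= eps%:E)%E.
  move: Fn qU.
  set a := (\int[_]_(z in F n) _)%E; set b := (\int[_]_(z in ~` F n) _)%E.
  have a0 : (0 <= a)%E by exact: integral_ge0.
  have b0 : (0 <= b)%E by exact: integral_ge0.
  case: a a0 => [a||]//; case: b b0 => [b||]// b0 a0.
  rewrite lte_fin -EFinD => h [] ab; rewrite lee_fin; lra.
have mqA D : measurable_fun D (fun z => (q z * \1_A z)%:E).
  apply/measurable_EFinP; apply: (measurable_funS measurableT) => //.
  by apply: measurable_funM => //; exact: measurable_indic.
have qA0 z : (0 <= (q z * \1_A z)%:E)%E by rewrite lee_fin mulr_ge0.
rewrite -{1}(setUv (F n)) ge0_integral_setU//; last 2 first.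
- exact: measurableC.
- exact/disj_setPCl.
apply: leeD; last first.
  apply: le_trans qC; apply: ge0_le_integral => //; first exact: measurableC.
  by move=> z _; rewrite lee_fin ler_piMr// indicE; case: (_ \in _).
have mB : measurable (box (0 : 'rV[R]_d) n%:R `&` A).
  by apply: measurableI => //; exact: measurable_box.
rewrite -[X in lebesgue_rV d X]setIT -(integral_indic _ measurableT mB).
rewrite -ge0_integralZl//; last first.
  by apply/measurable_EFinP; exact: measurable_indic.
apply: (@le_trans _ _ (\int[lebesgue_rV d]_(z in F n)
    (n%:R%:E * (\1_(box (0 : 'rV[R]_d) n%:R `&` A) z)%:E))%E).
  apply: ge0_le_integral => //.
  - apply/measurable_EFinP; apply: (measurable_funS measurableT) => //.
    by apply: measurable_funM => //; exact: measurable_indic.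
  move=> z [zn qn]; rewrite -EFinM lee_fin !indicE.
  have [Az|Az] := boolP (z \in A); last by rewrite mulr0 mulr_ge0.
  by rewrite mem_set ?mulr1//; split => //; rewrite -in_setE.
apply: ge0_subset_integral => //.
by apply/measurable_EFinP; apply: measurable_funM => //; exact: measurable_indic.
Qed.

(** Moving by e / N in the radial direction e lowers ln pi by more than 2 ln K
    when pi decays fast enough, while ln pi varies by at most 2 ln K on the
    region; hence the N translates by multiples of e / N are disjoint. *)
Lemma near_level_mass (K eps : R) : 1 <= K -> 0 < eps ->
  exists2 r : R, 0 < r & forall x, r < enorm x ->
  (\int[lebesgue_rV d]_y (q (y - x)%R * \1_(near_level K x) y)%:E <= eps%:E)%E.
Proof.
move=> K1 eps0; have K0 : 0 < K by apply: lt_le_trans K1.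
have eps20 : 0 < eps / 2 by rewrite divr_gt0.
have [n nP] := proposal_tail eps20.
have [c /andP[c0 c1] decP] := ln_density_decay_near pi_gt0 pi_C1 pi_tail pi_contour.
pose vol : R := (2 * (n%:R + 1)) ^+ d.
have vol0 : 0 <= vol by rewrite exprn_ge0// mulr_ge0// addr_ge0.
have nv0 : 0 <= n%:R * vol / (eps / 2) by rewrite divr_ge0 ?mulr_ge0// ltW.
pose N := (Num.bound (n%:R * vol / (eps / 2))).
have Nn : n%:R * vol <= eps / 2 * N%:R.
  by rewrite [leRHS]mulrC -ler_pdivrMr//; exact/ltW/archi_boundP.
have N0 : (0 : R) < N%:R by apply: le_lt_trans (archi_boundP nv0).
have lnK : 0 <= ln K by rewrite ln_ge0.
have L0 : 0 <= N%:R * (2 * ln K + 1) by rewrite mulr_ge0// addr_ge0// mulr_ge0.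
have D0 : 0 <= d%:R * n%:R :> R by rewrite mulr_ge0.
have [r r0 rP] := decP _ _ L0 D0.
exists r => // x rx; set e := unitv x.
have x0 : 0 < enorm x by apply: lt_trans rx.
have e1 : enorm e = 1 by exact: enorm_unitv.
pose A := [set z : 'rV[R]_d | near_level K x (z + x)].
have mA : measurable A.
  rewrite -[X in measurable X]setTI; apply: measurable_rV_add => //.
  exact: measurable_near_level.
pose A0 := box 0 n%:R `&` A.
have mA0 : measurable A0 by apply: measurableI => //; exact: measurable_box.
pose Ak (k : nat) := [set z : 'rV[R]_d | A0 (z + - ((k%:R / N%:R) *: e))].
have pack : (N%:R%:E * lebesgue_rV d A0 <= vol%:E)%E.
  have n10 : 0 < n%:R + 1 :> R by rewrite ltr_wpDl.
  rewrite /vol -(lebesgue_box (0 : 'rV[R]_d) n10).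
  apply: (@packing_bound _ _ _ _ N Ak); first exact: measurable_box.
    move=> k kN; split.
      by rewrite -[X in measurable X]setTI; apply: measurable_rV_add.
    split; last exact: lebesgue_rV_add.
    move=> z [zn _] i; rewrite mxE subr0.
    have h : `|z ord0 i - k%:R / N%:R * e ord0 i| <= n%:R.
      by have := zn i; rewrite /e !mxE subr0.
    rewrite -(subrK (k%:R / N%:R * e ord0 i) (z ord0 i)).
    apply: le_trans (ler_normD _ _) _; apply: lerD; first exact: h.
    rewrite normrM -[leRHS]mul1r ler_pM//.
      by rewrite ger0_norm ?divr_ge0// ler_pdivrMr// mul1r ler_nat ltnW.
    by rewrite -e1 coord_le_enorm.
  move=> j k z jk kN [zj [_ Ajz]] [zk [hk1 hk2]].
  set y1 := z + - ((k%:R / N%:R) *: e) in zk hk1 hk2.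
  set y2 := z + - ((j%:R / N%:R) *: e) in zj Ajz.
  pose T : R := (k - j)%:R / N%:R.
  have T01 : 0 <= T <= 1.
    rewrite divr_ge0//= ler_pdivrMr// mul1r ler_nat.
    by rewrite (leq_trans (leq_subr _ _))// ltnW.
  have TN : N%:R^-1 <= T.
    by rewrite -[leLHS]mul1r ler_pM2r ?invr_gt0// ler1n subn_gt0.
  have y2E : y2 + x = y1 + x + T *: e.
    apply/rowP => i; rewrite !mxE /T natrB 1?ltnW//; ring.
  have y1x : enorm (y1 + x - x) <= d%:R * n%:R.
    rewrite addrK; apply: enorm_le_box => i.
    by have := zk i; rewrite [X in _ - X]mxE subr0.
  have ee : enorm (e - unitv x) <= c.
    by rewrite subrr -(scale0r (0 : 'rV[R]_d)) enormZ normr0 mul0r ltW.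
  have := rP x rx (y1 + x) e T y1x ee T01; rewrite -y2E.
  have pix := pi_gt0 x.
  have l1 : ln (pi (y1 + x)) <= ln K + ln (pi x).
    by rewrite -lnM ?posrE// ler_ln ?posrE ?mulr_gt0 ?pi_gt0//.
  have l2 : ln (pi x) <= ln K + ln (pi (y2 + x)).
    by rewrite -lnM ?posrE// ler_ln ?posrE ?mulr_gt0 ?pi_gt0//.
  have : 2 * ln K + 1 <= N%:R * (2 * ln K + 1) * T.
    rewrite mulrAC -[leLHS]mul1r ler_wpM2r ?addr_ge0 ?mulr_ge0//.
    by rewrite mulrC -ler_pdivrMr// mul1r.
  lra.
have -> : (\int[lebesgue_rV d]_y (q (y - x)%R * \1_(near_level K x) y)%:E =
    \int[lebesgue_rV d]_z (q z * \1_A z)%:E)%E.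
  rewrite -(@ge0_integral_rV_add _ _ x
    (fun y => (q (y - x) * \1_(near_level K x) y)%:E)).
  - by apply: eq_integral => z _; rewrite addrK !indicE.
  - apply/measurable_EFinP; apply: measurable_funM; first exact: mqx.
    by apply: measurable_indic; exact: measurable_near_level.
  - by move=> y; rewrite lee_fin mulr_ge0.
apply: (le_trans (nP A mA)).
rewrite [leRHS](_ : _ = (eps / 2)%:E + (eps / 2)%:E)%E; last first.
  by rewrite -EFinD; congr EFin; lra.
apply: leeD2r; rewrite -/A0.
have -> : (n%:R%:E : \bar R) = ((n%:R / N%:R)%:E * N%:R%:E)%E.
  by rewrite -EFinM divfK// gt_eqF.
rewrite -muleA; apply: (@le_trans _ _ ((n%:R / N%:R)%:E * vol%:E)%E).
  by apply: lee_wpmul2l => //; rewrite lee_fin divr_ge0.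
by rewrite -EFinM lee_fin mulrAC ler_pdivrMr.
Qed.

End proposal_mass.

(** * Integrals against the pseudo-marginal kernel *)

Import HBNNSimple.

Section kernel_integrals.
Context {R : realType} {d : nat}.
Variables (W : set R) (Q : R.-pker 'rV[R]_d ~> R).
Hypothesis mW : measurable W.
Implicit Type F : 'rV[R]_d * R -> R.

Lemma measurable_pair_section (F : 'rV[R]_d * R -> R) (y : 'rV[R]_d) :
  measurable_fun setT F -> measurable_fun W (fun u => F (y, u)).
Proof.
move=> mF; apply: (@measurable_funTS _ _ _ _ W).
exact: (measurableT_comp mF (measurable_pair1 y)).
Qed.

Lemma measurable_weight_integral F : measurable_fun setT F -> (forall y u, W u -> 0 <= F (y, u)) ->
  measurable_fun setT (fun y => \int[Q y]_(u in W) (F (y, u))%:E)%E.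
Proof.
move=> mF F0; under eq_fun do rewrite integral_mkcond.
pose k (z : 'rV[R]_d * R) : \bar R := (F z * \1_W z.2)%:E.
have mk : measurable_fun setT k.
  apply/measurable_EFinP; apply: measurable_funM => //.
  apply: (@measurableT_comp _ _ _ _ _ _ (\1_W : R -> R)); last exact: measurable_snd.
  exact: measurable_indic.
have k0 z : (0 <= k z)%E.
  rewrite lee_fin indicE; case: (boolP (z.2 \in W)) => [|_]; last by rewrite mulr0.
  by rewrite inE mulr1; case: z => y u /=; exact: F0.
rewrite (_ : (fun _ => _) = fun y => \int[Q y]_u (k (y, u)))%E.
  exact: (measurable_fun_integral_sfinite_kernel k Q).
apply/funext => y; apply: eq_integral => u _.
rewrite /k patchE indicE; case: ifPn => /= _; by rewrite ?mulr1 ?mulr0.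
Qed.

Lemma weight_integral_ge0 F y : (forall y u, W u -> 0 <= F (y, u)) ->
  (0 <= \int[Q y]_(u in W) (F (y, u))%:E)%E.
Proof.
by move=> F0; apply: integral_ge0 => u Wu; rewrite lee_fin; exact: F0.
Qed.

Lemma le_proposal_weight_integral F G : measurable_fun setT F -> measurable_fun setT G ->
  (forall y u, W u -> 0 <= F (y, u)) ->
  (forall y u, W u -> F (y, u) <= G (y, u)) ->
  (\int[lebesgue_rV d]_y \int[Q y]_(u in W) (F (y, u))%:E <=
   \int[lebesgue_rV d]_y \int[Q y]_(u in W) (G (y, u))%:E)%E.
Proof.
move=> mF mG F0 FG.
have G0 y u : W u -> 0 <= G (y, u).
  by move=> Wu; exact: le_trans (F0 _ _ Wu) (FG _ _ Wu).
apply: ge0_le_integral => //.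
- by move=> y _; exact: weight_integral_ge0.
- exact: measurable_weight_integral.
- exact: measurable_weight_integral.
- move=> y _; apply: ge0_le_integral => //.
  + by move=> u Wu; rewrite lee_fin F0.
  + by apply/measurable_EFinP; exact: measurable_pair_section.
  + by apply/measurable_EFinP; exact: measurable_pair_section.
  + by move=> u Wu; rewrite lee_fin FG.
Qed.

(** The map sending a set to the proposal mass of its accepted part is additive,
    so its integral of a simple function is again a double integral. *)
Lemma proposal_weight_integral_nnsfun F (h : {nnsfun ('rV[R]_d * R) >-> R}) :
  measurable_fun setT F -> (forall y u, W u -> 0 <= F (y, u)) ->
  (\sum_(r \in range h) r%:E *
     \int[lebesgue_rV d]_y \int[Q y]_(u in W)
       (F (y, u) * \1_(h @^-1` [set r]) (y, u))%:E =
   \int[lebesgue_rV d]_y \int[Q y]_(u in W) (F (y, u) * h (y, u))%:E)%E.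
Proof.
move=> mF F0.
have mFi r : measurable_fun setT (fun z => F z * \1_(h @^-1` [set r]) z).
  by apply: measurable_funM => //; exact: measurable_indic.
have Fi0 r y u : W u -> 0 <= F (y, u) * \1_(h @^-1` [set r]) (y, u).
  by move=> Wu; rewrite mulr_ge0// F0.
have mrFi r : measurable_fun setT (fun z => r * (F z * \1_(h @^-1` [set r]) z)).
  exact: measurable_funM.
have rFi0 r y u : W u -> 0 <= r * (F (y, u) * \1_(h @^-1` [set r]) (y, u)).
  move=> Wu; have [r0|r0] := leP 0 r; first by rewrite mulr_ge0// Fi0.
  by rewrite preimage_nnfun0// indic0 !mulr0.
transitivity (\sum_(r \in range h)
   \int[lebesgue_rV d]_y \int[Q y]_(u in W)
       (r * (F (y, u) * \1_(h @^-1` [set r]) (y, u)))%:E)%E.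
  apply: eq_fsbigr => r; rewrite inE => -[z _ <-].
  rewrite -ge0_integralZl//.
  - apply: eq_integral => y _; rewrite -ge0_integralZl//.
    + by apply/measurable_EFinP; exact: (measurable_pair_section y (mFi (h z))).
    + by move=> u Wu; rewrite lee_fin (Fi0 (h z) y u).
    + by rewrite lee_fin.
  - exact: (measurable_weight_integral (mFi (h z)) (Fi0 (h z))).
  - by move=> y _; apply: integral_ge0 => u Wu; rewrite lee_fin Fi0.
  - by rewrite lee_fin.
rewrite -ge0_integral_fsum//.
- apply: eq_integral => y _; rewrite -ge0_integral_fsum//.
  + apply: eq_integral => u _; rewrite fsumEFin//; congr (_%:E).
    rewrite [in RHS]fimfunE.
    rewrite !fsbig_finite//= mulr_sumr; apply: eq_bigr => r _.
    by rewrite mulrCA.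
  + by move=> r; apply/measurable_EFinP; exact: (measurable_pair_section y (mrFi r)).
  + by move=> r u Wu; rewrite lee_fin (rFi0 r y u).
- by move=> r; exact: (measurable_weight_integral (mrFi r) (rFi0 r)).
- by move=> r y _; apply: integral_ge0 => u Wu; rewrite lee_fin rFi0.
Qed.

End kernel_integrals.

Lemma ge0_integralZl_fin dT (T : measurableType dT) (R : realType)
  (mu : {measure set T -> \bar R})
  (D : set T) (f : T -> \bar R) (k : R) : measurable D ->
  measurable_fun D f -> (forall t, D t -> 0 <= f t)%E -> 0 <= k ->
  (\int[mu]_(t in D) (k%:E * f t) = k%:E * \int[mu]_(t in D) f t)%E.
Proof. by move=> mD mf f0 k0; rewrite ge0_integralZl. Qed.

(** For a set function that is not known to be a measure, the integral is still
    the supremum of the integrals of simple functions below the integrand. *)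
Lemma ge0_integral_set_function_le d (T : measurableType d) (R : realType)
    (mu : set T -> \bar R) (D : set T) (f : T -> R) (b : \bar R) :
  mu set0 = 0%E -> (forall x, 0 <= f x) ->
  (forall h : {nnsfun T >-> R}, (forall x, h x <= (f \_ D) x) ->
    (sintegral mu h <= b)%E) ->
  (\int[mu]_(x in D) (f x)%:E <= b)%E.
Proof.
move=> mu0 f0 fb; rewrite /integral.
set f1 := (EFin \o f).
have f10 x : D x -> (0 <= f1 x)%E by rewrite lee_fin.
rewrite funepos_restrict funeneg_restrict -/f1.
have /eq_restrictP-> := ge0_funeposE f10.
have /eq_restrictP-> := ge0_funenegE f10.
rewrite erestrict0.
rewrite -[b]sube0; apply: leeB.
  apply: ge_ereal_sup => _ [h hf <-]; apply: fb => x.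
  by have := hf x; rewrite !patchE; case: ifPn => _; rewrite lee_fin.
apply: ereal_sup_ubound; exists nnsfun0 => //=.
rewrite /sintegral fsbig1// => x _.
have [->|x0] := eqVneq x 0; first by rewrite mul0e.
rewrite preimage10 ?mu0 ?mule0// => -[y _ /=] xE.
by rewrite -xE eqxx in x0.
Qed.

Section pseudo_marginal_drift.
Context {R : realType} {d : nat}.
Variables (pi q : 'rV[R]_d -> R) (W : set R) (Q : R.-pker 'rV[R]_d ~> R).
Hypothesis mpi : measurable_fun setT pi.
Hypothesis pi_gt0 : forall x, 0 < pi x.
Hypothesis q_density : probability_density q.
Hypothesis WQ : weight_kernel W Q.
Variables (x : 'rV[R]_d) (w : R).
Hypothesis Ww : W w.

Let mW : measurable W. Proof. by case: WQ. Qed.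

Let W_gt0 u : W u -> 0 < u.
Proof. by case: WQ => _ + _ _ Wu => /(_ u Wu) /=; rewrite in_itv/= andbT. Qed.

Lemma weight_setW y : Q y W = 1%E.
Proof.
case: WQ => _ _ QW _; rewrite -[RHS](prob_kernel (s := Q) y).
have -> : [set: R] = W `|` ~` W by rewrite setUv.
transitivity (Q y W + Q y (~` W))%E; first by rewrite QW adde0.
exact/esym/(measureU (Q y) mW (measurableC mW) (setICr W)).
Qed.

Lemma pm_acceptance_ge0 y u : W u -> 0 <= pm_acceptance pi x w y u.
Proof.
move=> Wu; have p0 v := ltW (pi_gt0 v).
have w0 := ltW (W_gt0 Ww); have u0 := ltW (W_gt0 Wu).
by rewrite le_min ler01 mulr_ge0// divr_ge0.
Qed.

Lemma pm_acceptance_le1 y u : pm_acceptance pi x w y u <= 1.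
Proof. by rewrite ge_min lexx. Qed.

Lemma measurable_pm_acceptance :
  measurable_fun setT (fun z : 'rV[R]_d * R => pm_acceptance pi x w z.1 z.2).
Proof.
apply: measurable_minr => //; apply: measurable_funM.
  by apply: measurable_funM => //; exact: (measurableT_comp mpi measurable_fst).
by apply: measurable_funM => //; exact: measurable_snd.
Qed.

Let mq : measurable_fun setT q. Proof. by case: q_density. Qed.

Let q0 v : 0 <= q v. Proof. by case: q_density. Qed.

Lemma measurable_proposal : measurable_fun setT (fun y : 'rV[R]_d => q (y - x)).
Proof. exact: (measurableT_comp mq (measurable_rV_add (- x))). Qed.

Lemma proposal_mass : (\int[lebesgue_rV d]_y (q (y - x)%R)%:E = 1)%E.
Proof.
case: q_density => _ _ <-.
rewrite (@ge0_integral_rV_add _ _ (- x) (fun y => (q y)%:E))//.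
exact/measurable_EFinP.
Qed.

Let aq (z : 'rV[R]_d * R) := pm_acceptance pi x w z.1 z.2 * q (z.1 - x).

Let maq : measurable_fun setT aq.
Proof.
apply: measurable_funM; first exact: measurable_pm_acceptance.
exact: (measurableT_comp measurable_proposal measurable_fst).
Qed.

Let aq0 y u : W u -> 0 <= aq (y, u).
Proof. by move=> Wu; rewrite mulr_ge0// pm_acceptance_ge0. Qed.

Lemma pm_rejection_ge0 : (0 <= pm_rejection pi q W Q x w)%E.
Proof.
rewrite /pm_rejection sube_ge0 ?orbT//.
rewrite -proposal_mass.
rewrite [leRHS](_ : _ =
    \int[lebesgue_rV d]_y \int[Q y]_(u in W) (q ((y, u).1 - x)%R)%:E)%E.
  apply: (@le_proposal_weight_integral _ _ _ _ mW aq (fun z => q (z.1 - x))) => //.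
  - exact: (measurableT_comp measurable_proposal measurable_fst).
  - by move=> y u Wu; rewrite ler_piMl// pm_acceptance_le1.
apply: eq_integral => y _; rewrite /= integral_cst// weight_setW mule1//.
Qed.

(** The bound is obtained for every simple function below V, the rejection part
    being a point mass at (x, w). *)
Lemma pm_apply_le (V : 'rV[R]_d * R -> R) :
  measurable_fun setT V -> (forall z, 0 <= V z) ->
  (pm_apply pi q W Q V (x, w) <=
   \int[lebesgue_rV d]_y \int[Q y]_(u in W) (aq (y, u) * V (y, u))%:E
   + pm_rejection pi q W Q x w * (V (x, w))%:E)%E.
Proof.
move=> mV V0; apply: ge0_integral_set_function_le => //.
  rewrite /pm_kernel dirac0 mule0 adde0 integral0_eq// => y _.
  by apply: integral0_eq => u _; rewrite indic0 mulr0.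
move=> h hV.
have {}hV z : h z <= V z.
  by apply: le_trans (hV z) _; rewrite patchE; case: ifP.
set rej := pm_rejection pi q W Q x w.
have rej0 : (0 <= rej)%E := pm_rejection_ge0.
have mah : measurable_fun setT (fun z : 'rV[R]_d * R => aq z * h z).
  exact: measurable_funM.
have outer0 r : (0 <= \int[lebesgue_rV d]_y \int[Q y]_(u in W)
    (aq (y, u) * \1_(h @^-1` [set r]) (y, u))%:E)%E.
  apply: integral_ge0 => y _; apply: integral_ge0 => u Wu.
  by rewrite lee_fin mulr_ge0// aq0.
have -> : sintegral (pm_kernel pi q W Q (x, w)) h = (\sum_(r \in range h)
    (r%:E * \int[lebesgue_rV d]_y \int[Q y]_(u in W)
      (aq (y, u) * \1_(h @^-1` [set r]) (y, u))%:E
    + r%:E * (rej * \d_(x, w) (h @^-1` [set r]))))%E.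
  rewrite /sintegral -(fsbig_widen (range h) setT)//=; last first.
    move=> r [_ Nhr] /=; rewrite preimage10// /pm_kernel dirac0 mule0 adde0.
    rewrite integral0_eq ?mule0// => y _.
    by apply: integral0_eq => u _; rewrite indic0 mulr0.
  apply: eq_fsbigr => r; rewrite inE => -[z _ <-].
  by rewrite -ge0_muleDr// mule_ge0.
rewrite fsbig_split//= (proposal_weight_integral_nnsfun Q mW h maq aq0).
apply: leeD.
  apply: (@le_proposal_weight_integral _ _ _ _ mW (fun z => aq z * h z) (fun z => aq z * V z)) => //.
  - exact: measurable_funM.
  - by move=> y u Wu; rewrite mulr_ge0// aq0.
  - by move=> y u Wu; rewrite ler_wpM2l// aq0.
rewrite (fsbigD1 (h (x, w)))//=; last by exists (x, w).
rewrite fsbig1 ?adde0.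
  by rewrite diracE mem_set// mule1 muleC lee_wpmul2l// lee_fin.
move=> r [_ /= rh]; rewrite diracE memNset ?mule0//=.
by move=> hr; apply: rh.
Qed.

(** A mass A of accepted proposals is traded for V (x, w) A of the current value,
    so that an excess of the accepted mass over the accepted drift is a decrease
    of V.  The loss g and the gain f stand on opposite sides to keep all
    integrands nonnegative. *)
Lemma pm_drift (V : 'rV[R]_d * R -> R) (f g : 'rV[R]_d -> R) (a b : R) :
  measurable_fun setT V -> (forall z, 0 <= V z) -> 0 < V (x, w) ->
  measurable_fun setT f -> (forall y, 0 <= f y) ->
  measurable_fun setT g -> (forall y, 0 <= g y) ->
  (\forall y \ae lebesgue_rV d,
    \int[Q y]_(u in W) (pm_acceptance pi x w y u * (V (y, u) / V (x, w)))%:E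
      + (f y)%:E
    <= \int[Q y]_(u in W) (pm_acceptance pi x w y u)%:E + (g y)%:E)%E ->
  (a%:E <= \int[lebesgue_rV d]_y (q (y - x)%R * f y)%:E)%E ->
  (\int[lebesgue_rV d]_y (q (y - x)%R * g y)%:E <= b%:E)%E ->
  (pm_apply pi q W Q V (x, w) <= (V (x, w) * (1 + b - a))%:E)%E.
Proof.
move=> mV V0 Vxw mf f0 mg g0 fg af gb.
set v := V (x, w) in Vxw fg *.
have mqx := measurable_proposal.
pose I y := (\int[Q y]_(u in W) (pm_acceptance pi x w y u * (V (y, u) / v))%:E)%E.
pose J y := (\int[Q y]_(u in W) (pm_acceptance pi x w y u)%:E)%E.
pose aVz (z : 'rV[R]_d * R) := pm_acceptance pi x w z.1 z.2 * (V z / v).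
pose az (z : 'rV[R]_d * R) := pm_acceptance pi x w z.1 z.2.
have maVz : measurable_fun setT aVz.
  by apply: measurable_funM; [exact: measurable_pm_acceptance|exact: measurable_funM].
have aVz0 y u : W u -> 0 <= aVz (y, u).
  by move=> Wu; rewrite mulr_ge0 ?pm_acceptance_ge0// divr_ge0// ltW.
have az0 y u : W u -> 0 <= az (y, u) by move=> Wu; rewrite pm_acceptance_ge0.
have mI : measurable_fun setT I := @measurable_weight_integral _ _ _ Q mW _ maVz aVz0.
have mJ : measurable_fun setT J :=
  @measurable_weight_integral _ _ _ Q mW _ measurable_pm_acceptance az0.
have I0 y : (0 <= I y)%E by apply: integral_ge0 => u Wu; rewrite lee_fin aVz0.
have J0 y : (0 <= J y)%E by apply: integral_ge0 => u Wu; rewrite lee_fin az0.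
have mqE : measurable_fun setT (fun y : 'rV[R]_d => (q (y - x))%:E).
  exact/measurable_EFinP.
have qE0 (y : 'rV[R]_d) : (0 <= (q (y - x))%:E)%E by rewrite lee_fin.
pose A := (\int[lebesgue_rV d]_y ((q (y - x)%R)%:E * J y))%E.
have AE : A = (\int[lebesgue_rV d]_y \int[Q y]_(u in W) (aq (y, u))%:E)%E.
  apply: eq_integral => y _; rewrite -ge0_integralZl_fin//.
  - by apply: eq_integral => u _; rewrite -EFinM mulrC.
  - by apply/measurable_EFinP; exact: (measurable_pair_section y measurable_pm_acceptance).
  - by move=> u Wu; rewrite lee_fin az0.
have TE : (\int[lebesgue_rV d]_y \int[Q y]_(u in W) (aq (y, u) * V (y, u))%:E
    = v%:E * \int[lebesgue_rV d]_y ((q (y - x)%R)%:E * I y))%E.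
  rewrite -ge0_integralZl_fin//; last 3 first.
  - by apply: emeasurable_funM.
  - by move=> y _; rewrite mule_ge0.
  - exact: ltW.
  apply: eq_integral => y _; rewrite muleA -EFinM -ge0_integralZl_fin//.
  - apply: eq_integral => u _; rewrite -EFinM; congr EFin.
    by rewrite /aq /=; field; rewrite gt_eqF.
  - by apply/measurable_EFinP; exact: (measurable_pair_section y maVz).
  - by move=> u Wu; rewrite lee_fin aVz0.
  - by rewrite mulr_ge0// ltW.
have main : (\int[lebesgue_rV d]_y ((q (y - x)%R)%:E * I y) + a%:E <= A + b%:E)%E.
  apply: (@le_trans _ _ (\int[lebesgue_rV d]_y ((q (y - x)%R)%:E * I y)
     + \int[lebesgue_rV d]_y (q (y - x)%R * f y)%:E)%E); first exact: leeD.
  apply: (@le_trans _ _ (A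
     + \int[lebesgue_rV d]_y (q (y - x)%R * g y)%:E)%E); last exact: leeD.
  have mqf : measurable_fun setT (fun y : 'rV[R]_d => (q (y - x) * f y)%:E).
    by apply/measurable_EFinP; exact: measurable_funM.
  have mqg : measurable_fun setT (fun y : 'rV[R]_d => (q (y - x) * g y)%:E).
    by apply/measurable_EFinP; exact: measurable_funM.
  have mqI : measurable_fun setT (fun y : 'rV[R]_d => (q (y - x))%:E * I y)%E.
    exact: emeasurable_funM.
  have mqJ : measurable_fun setT (fun y : 'rV[R]_d => (q (y - x))%:E * J y)%E.
    exact: emeasurable_funM.
  rewrite /A -!ge0_integralD//; try by move=> y _; rewrite ?mule_ge0// lee_fin mulr_ge0.
  apply: ae_ge0_le_integral => //.
  - by move=> y _; rewrite adde_ge0// ?mule_ge0// lee_fin mulr_ge0.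
  - exact: emeasurable_funD.
  - by move=> y _; rewrite adde_ge0// ?mule_ge0// lee_fin mulr_ge0.
  - exact: emeasurable_funD.
  apply: filterS fg => y fgy _.
  rewrite !EFinM -!ge0_muleDr//; try by rewrite lee_fin.
  exact: lee_wpmul2l.
have A1 : (A <= 1)%E.
  by have := pm_rejection_ge0; rewrite /pm_rejection sube_ge0 ?orbT// AE.
have A0 : (0 <= A)%E by apply: integral_ge0 => y _; rewrite mule_ge0.
have Afin : A \is a fin_num by rewrite ge0_fin_numE// (le_lt_trans A1) ?ltry.
apply: (le_trans (pm_apply_le mV V0)); rewrite TE -/v.
have -> : pm_rejection pi q W Q x w = (1 - A)%E by rewrite AE.
have AR := fineK Afin; rewrite -AR in main *.
have h : (\int[lebesgue_rV d]_y ((q (y - x)%R)%:E * I y)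
    <= (fine A + b - a)%:E)%E.
  by rewrite EFinB leeBrDr.
have v0 : (0 <= v%:E)%E by rewrite lee_fin ltW.
apply: (le_trans (leeD (lee_wpmul2l v0 h) (lexx _))).
rewrite -EFinB -!EFinM -EFinD lee_fin; lra.
Qed.
End pseudo_marginal_drift.

(** * Powers of the weight *)

Section power_bounds.
Context {R : realType}.
Implicit Types u w r p a b e t : R.

Lemma powR_decay_large a b e : 0 < b -> 0 < e ->
  exists2 w0 : R, 1 <= w0 & forall w, w0 <= w -> a * w `^ (- e) <= b.
Proof.
move=> b0 e0; exists (Num.max 1 ((`|a| / b) `^ e^-1)).
  by rewrite le_max lexx.
move=> w; rewrite ge_max => /andP[w1 wab].
have w0 : 0 < w by apply: lt_le_trans w1.
rewrite powRN -ler_pdivlMr ?invr_gt0 ?powR_gt0// invrK.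
apply: (le_trans (ler_norm a)); rewrite mulrC -ler_pdivrMr//.
have ab0 : 0 <= `|a| / b by rewrite divr_ge0// ltW.
rewrite -[leLHS]powRr1// -(@mulVf _ e) ?gt_eqF// powRrM.
by rewrite ge0_ler_powR ?nnegrE ?powR_ge0// ltW.
Qed.

Lemma powR_decay_small a b e : 0 < b -> 0 < e ->
  exists2 w0 : R, 0 < w0 <= 1 & forall w, 0 < w <= w0 -> a * w `^ e <= b.
Proof.
move=> b0 e0; have [w0 w01 h] := powR_decay_large a b0 e0.
have w00 : 0 < w0 by apply: lt_le_trans w01.
exists w0^-1; first by rewrite invr_gt0 w00 invf_le1.
move=> w /andP[w_gt0 ww0].
rewrite (_ : w `^ e = (w^-1) `^ (- e)).
  by apply: h; rewrite -[leLHS]invrK lef_pV2// posrE invr_gt0.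
by rewrite powRN -(powR_inv1 (ltW w_gt0)) -powRrM mulN1r powRN invrK.
Qed.

(** This turns the acceptance probability into a power of the ratio, with an
    exponent free to be tuned. *)
Lemma min1_le_powR t p : 0 < t -> 0 <= p <= 1 -> Num.min 1 t <= t `^ p.
Proof.
move=> t0 /andP[p0 p1]; have [t1|t1] := leP 1 t.
  by rewrite -(powRr0 t) ler_powR.
by rewrite -[leLHS](powRr1 (ltW t0)) ger_powR// t0 ltW.
Qed.

Definition two_sided_power a b u := Num.max (u `^ (- a)) (u `^ b).
Local Notation psi := two_sided_power.

(** The exponent e lies between - a and b, so that u ^ e is dominated by u ^ b
    for u >= 1 and by u ^ - a for u <= 1. *)
Lemma powR_le_two_sided a b e u : 0 < u -> - a <= e <= b ->
  u `^ e <= psi a b u.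
Proof.
move=> u0 /andP[ae eb]; rewrite le_max; have [u1|u1] := leP 1 u.
  by apply/orP; right; rewrite ler_powR.
by apply/orP; left; rewrite ger_powR// u0 ltW.
Qed.

Lemma two_sided_power_ge1 a b u : 0 <= a -> 0 <= b -> 0 < u -> 1 <= psi a b u.
Proof.
move=> a0 b0 u0; rewrite -(powRr0 u); apply: powR_le_two_sided => //.
by rewrite oppr_le0 a0.
Qed.

Lemma two_sided_power_ge0 a b u : 0 <= psi a b u.
Proof. by rewrite le_max powR_ge0. Qed.

Lemma measurable_two_sided_power a b : measurable_fun setT (psi a b).
Proof. by apply: measurable_maxr; exact: measurable_powR. Qed.

Lemma two_sided_power_large a b u : 0 <= a -> 0 <= b -> 1 <= u ->
  psi a b u = u `^ b.
Proof.
move=> a0 b0 u1; apply/max_idPr; rewrite ler_powR//.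
by rewrite (le_trans _ b0)// oppr_le0.
Qed.

Lemma two_sided_power_small a b u : 0 <= a -> 0 <= b -> 0 < u <= 1 ->
  psi a b u = u `^ (- a).
Proof.
move=> a0 b0 u1; apply/max_idPl; rewrite ger_powR//.
by rewrite (le_trans _ b0)// oppr_le0.
Qed.

Lemma powR_mul_two_sided a b a' b' p u : 0 < u -> 0 <= a <= a' -> 0 <= b ->
  0 <= p -> p + b <= b' ->
  u `^ p * psi a b u <= psi a' b' u.
Proof.
move=> u0 /andP[a0 aa'] b0 p0 pb.
have un0 e : (e == 0) ==> (u != 0) by apply/implyP => _; rewrite gt_eqF.
rewrite maxr_pMr ?powR_ge0// -(powRD (un0 _)) -(powRD (un0 _)).

rewrite ge_max; apply/andP; split; apply: powR_le_two_sided => //;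
  apply/andP; split; lra.
Qed.

Lemma two_sided_power_le a b a' b' u : 0 < u -> 0 <= a <= a' -> 0 <= b <= b' ->
  psi a b u <= psi a' b' u.
Proof.
move=> u0 aa' /andP[b0 bb'].
have := @powR_mul_two_sided a b a' b' 0 u u0 aa' b0.
by rewrite powRr0 mul1r add0r; exact.
Qed.

End power_bounds.

(** * Accepted mass and accepted drift of one proposed point *)

Section weight_estimates.
Context {R : realType}.
Variables (alpha' beta' eta alpha beta M : R).
Hypotheses (alpha'_gt0 : 0 < alpha') (beta'_gt1 : 1 < beta').
Hypotheses (eta_gt0 : 0 < eta) (eta_lt1 : eta < 1).
Hypotheses (alpha_gt : eta < alpha) (alpha_le : alpha <= alpha').
Hypotheses (beta_gt0 : 0 < beta) (beta_lt : beta < beta' - eta).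
Hypothesis M_ge1 : 1 <= M.

Local Notation psi := (two_sided_power alpha beta).
Local Notation psi' := (two_sided_power alpha' beta').

Definition weight_law (W : set R) (mu : {measure set R -> \bar R}) :=
  [/\ measurable W, forall u, W u -> 0 < u, mu W = 1%E &
      (\int[mu]_(u in W) (psi' u)%:E <= M%:E)%E].

Definition accept (r w u : R) : R := Num.min 1 (r * (u / w)).

Definition drift_ratio (r w u : R) : R := r `^ (- eta) * (psi u / psi w).

Definition accepted_mass W (mu : {measure set R -> \bar R}) r w :=
  (\int[mu]_(u in W) (accept r w u)%:E)%E.

(** Here r stands for pi y / pi x, and W, mu for the law of the proposed weight. *)
Definition accepted_drift W (mu : {measure set R -> \bar R}) r w :=
  (\int[mu]_(u in W) (accept r w u * drift_ratio r w u)%:E)%E.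

Local Notation J := accepted_mass.
Local Notation I := accepted_drift.

Let M0 : 0 < M. Proof. exact: lt_le_trans M_ge1. Qed.

Let alpha_gt0 : 0 < alpha. Proof. exact: lt_trans alpha_gt. Qed.

Let beta'_gt0 : 0 < beta'. Proof. exact: lt_trans beta'_gt1. Qed.

Let psi_ge1 u : 0 < u -> 1 <= psi u.
Proof. by apply: two_sided_power_ge1; exact: ltW. Qed.

Let psi_gt0 u : 0 < u -> 0 < psi u.
Proof. by move=> u0; exact: lt_le_trans (psi_ge1 u0). Qed.

Let psi'_ge0 u : 0 <= psi' u. Proof. exact: two_sided_power_ge0. Qed.

Lemma measurable_accept r w : measurable_fun setT (accept r w).
Proof.
by apply: measurable_minr => //; apply: measurable_funM => //; exact: measurable_funM.
Qed.

Lemma measurable_drift_ratio r w : measurable_fun setT (drift_ratio r w).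
Proof.
apply: measurable_funM => //; apply: measurable_funM => //.
exact: measurable_two_sided_power.
Qed.

Lemma accept_ge0 r w u : 0 < r -> 0 < w -> 0 < u -> 0 <= accept r w u.
Proof. by move=> r0 w0 u0; rewrite le_min ler01 ltW// mulr_gt0// divr_gt0. Qed.

Lemma accept_le1 r w u : accept r w u <= 1.
Proof. by rewrite ge_min lexx. Qed.

Lemma drift_ratio_ge0 r w u : 0 <= drift_ratio r w u.
Proof. by rewrite mulr_ge0 ?powR_ge0// divr_ge0 ?two_sided_power_ge0. Qed.

(** Pointwise inequalities may spend a multiple l of the moment function, which
    costs l M after integration.  In particular a bound required only where
    the moment function is at most 2 M follows by spending 1 / (2 M) of it: this is
    Markov's inequality without the exceptional set. *)
Lemma weight_law_le_integral W (mu : {measure set R -> \bar R}) (F1 F2 : R -> R)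
    (k l : R) : weight_law W mu ->
  measurable_fun setT F1 -> measurable_fun setT F2 ->
  (forall u, W u -> 0 <= F1 u) -> (forall u, W u -> 0 <= F2 u) ->
  0 <= k -> 0 <= l ->
  (forall u, W u -> F1 u + k <= F2 u + l * psi' u) ->
  (\int[mu]_(u in W) (F1 u)%:E + k%:E
   <= \int[mu]_(u in W) (F2 u)%:E + (l * M)%:E)%E.
Proof.
move=> [mW W0 W1 WM] mF1 mF2 F10 F20 k0 l0 F12.
have mE (F : R -> R) : measurable_fun setT F ->
    measurable_fun W (fun u => (F u)%:E).
  by move=> mF; apply/measurable_EFinP; exact: (measurable_funS measurableT).
have mpsi : measurable_fun setT psi' := measurable_two_sided_power _ _.
have {1}-> : k%:E = (\int[mu]_(u in W) k%:E)%E.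
  by rewrite integral_cst// W1 mule1.
apply: (@le_trans _ _ (\int[mu]_(u in W) (F2 u)%:E
    + \int[mu]_(u in W) (l%:E * (psi' u)%:E))%E); last first.
  apply: leeD => //; rewrite ge0_integralZl//; last 2 first.
  - exact: mE.
  - by move=> u _; rewrite lee_fin.
  by rewrite EFinM lee_wpmul2l ?lee_fin.
rewrite -!ge0_integralD//.
- apply: ge0_le_integral => //.
  + by move=> u Wu; rewrite -EFinD lee_fin addr_ge0// F10.
  + exact: (mE (fun u => F1 u + k) (measurable_funD mF1 (measurable_cst k))).
  + apply: (mE (fun u => F2 u + l * psi' u)).
    by apply: measurable_funD => //; exact: measurable_funM.
- exact: mE.
- by move=> u _; rewrite -EFinM lee_fin mulr_ge0.
- by apply: (mE (fun u => l * psi' u)); exact: measurable_funM.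
- exact: mE.
Qed.

Section one_law.
Variables (W : set R) (mu : {measure set R -> \bar R}) (r w : R).
Hypotheses (Wmu : weight_law W mu) (r0 : 0 < r) (w0 : 0 < w).

Let W_gt0 u : W u -> 0 < u. Proof. by case: Wmu => _ + _ _; exact. Qed.

Let mI : measurable_fun setT (fun u => accept r w u * drift_ratio r w u).
Proof.
apply: measurable_funM; first exact: measurable_accept.
exact: measurable_drift_ratio.
Qed.

Let I0 u : W u -> 0 <= accept r w u * drift_ratio r w u.
Proof.
by move=> Wu; rewrite mulr_ge0 ?drift_ratio_ge0// accept_ge0// W_gt0.
Qed.

Let J0 u : W u -> 0 <= accept r w u.
Proof. by move=> Wu; rewrite accept_ge0// W_gt0. Qed.

Lemma accepted_drift_le p : 0 <= p <= 1 -> p + beta <= beta' ->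
  (I W mu r w <= (r `^ (p - eta) * w `^ (- p) / psi w * M)%:E)%E.
Proof.
move=> /andP[p0 p1] pb.
have c0 : 0 <= r `^ (p - eta) * w `^ (- p) / psi w.
  by rewrite divr_ge0 ?two_sided_power_ge0// mulr_ge0// powR_ge0.
have := @weight_law_le_integral W mu
  (fun u => accept r w u * drift_ratio r w u) (cst 0) 0 _ Wmu mI
  (measurable_cst _) I0 (fun _ _ => lexx _) (lexx _) c0.
rewrite integral0 adde0 add0e; apply => u Wu; have u0 := W_gt0 Wu.
rewrite addr0 add0r /drift_ratio.
have rwu : 0 < r * (u / w) by rewrite mulr_gt0// divr_gt0.
have acc : accept r w u <= r `^ p * (u `^ p * w `^ (- p)).
  have p01 : 0 <= p <= 1 by rewrite p0 p1.
  apply: (le_trans (min1_le_powR rwu p01)).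
  have wV : 0 <= w^-1 by rewrite invr_ge0 ltW.
  rewrite (powRM _ (ltW r0) (mulr_ge0 (ltW u0) wV)) (powRM _ (ltW u0) wV).
  by rewrite -(powR_inv1 (ltW w0)) -powRrM mulN1r.
apply: (@le_trans _ _ (r `^ p * (u `^ p * w `^ (- p)) *
    (r `^ (- eta) * (psi u / psi w)))).
  by rewrite ler_wpM2r// drift_ratio_ge0.
have -> : r `^ (p - eta) = r `^ p * r `^ (- eta).
  by rewrite powRD//; apply/implyP => _; rewrite gt_eqF.
have -> : r `^ p * (u `^ p * w `^ (- p)) * (r `^ (- eta) * (psi u / psi w)) =
   r `^ p * r `^ (- eta) * w `^ (- p) / psi w * (u `^ p * psi u) by ring.
rewrite ler_wpM2l//.
  by rewrite divr_ge0 ?two_sided_power_ge0// !mulr_ge0// powR_ge0.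
by apply: powR_mul_two_sided => //; [rewrite (ltW alpha_gt0)|exact: ltW].
Qed.

(** The lower end of the range of weights u with u ^ - alpha' at most 2 M. *)
Definition typical_weight : R := (2 * M) `^ (- alpha'^-1).

Local Notation s := typical_weight.

Lemma typical_weight_gt0 : 0 < s.
Proof. by rewrite powR_gt0// mulr_gt0. Qed.

Lemma typical_weight_le1 : s <= 1.
Proof.
rewrite /typical_weight powRN invf_le1 ?powR_gt0 ?mulr_gt0//.
rewrite -[leLHS](powRr0 (2 * M)) ler_powR ?invr_ge0 ?(ltW alpha'_gt0)//.
by have := M_ge1; lra.
Qed.

Lemma typical_weight_le u : 0 < u -> psi' u <= 2 * M -> s <= u.
Proof.
move=> u0; rewrite ge_max => /andP[uM _]; rewrite leNgt; apply/negP => us.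
have s0 := typical_weight_gt0.
have : s `^ (- alpha') < u `^ (- alpha').
  rewrite !powRN ltf_pV2 ?posrE; [|exact: powR_gt0|exact: powR_gt0].
  by rewrite gt0_ltr_powR// nnegrE ltW.
rewrite /typical_weight -powRrM mulrNN mulVf ?gt_eqF// powRr1; last by rewrite mulr_ge0 ?ltW.
by move=> /lt_le_trans/(_ uM); rewrite ltxx.
Qed.

Lemma accept_typical u : 0 < u -> psi' u <= 2 * M ->
  Num.min 1 (r * (s / w)) <= accept r w u.
Proof.
move=> u0 uM; rewrite le_min ge_min lexx ge_min/=; apply/orP; right.
by rewrite ler_pM2l// ler_pM2r ?invr_gt0// typical_weight_le.
Qed.

Let m := Num.min 1 (r * (s / w)).

Let m0 : 0 <= m.
Proof.
by rewrite le_min ler01 ltW// mulr_gt0// divr_gt0// typical_weight_gt0.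
Qed.

Lemma accepted_mass_ge : ((m / 2)%:E <= J W mu r w)%E.
Proof.
have mM0 : 0 <= m / (2 * M) by rewrite divr_ge0// mulr_ge0// ltW.
have := @weight_law_le_integral W mu (cst 0) (accept r w) m (m / (2 * M)) Wmu
  (measurable_cst _) (measurable_accept r w) (fun _ _ => lexx _) J0 m0 mM0.
have -> : m / (2 * M) * M = m / 2 by field; rewrite gt_eqF.
rewrite integral0 add0e => h.
have : (m%:E <= J W mu r w + (m / 2)%:E)%E.
  apply: h => u Wu; have u0 := W_gt0 Wu; rewrite /= add0r.
  have [uM|uM] := leP (psi' u) (2 * M).
    apply: (@le_trans _ _ (accept r w u)); first exact: accept_typical.
    by rewrite lerDl mulr_ge0.
  apply: (@le_trans _ _ (m / (2 * M) * psi' u)); last by rewrite lerDr J0.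
  by rewrite mulrAC ler_pdivlMr ?mulr_gt0// ler_wpM2l// ltW.
rewrite -leeBlDr// -EFinB; apply: le_trans; rewrite lee_fin; lra.
Qed.

(** For r bounded below, typical weights u lose against w, since psi u / psi w is
    small.  Weights u <= 1 may have a large psi u, but are accepted with
    probability at most min 1 (r / w), comparable to the gain.  Weights u > 1
    increase V only if u is of order at least w, which costs w ^ - beta'. *)
Lemma accepted_drift_large kappa : 0 < kappa <= 1 -> kappa <= r -> 1 <= w ->
  kappa `^ (- eta) * (2 * M) * w `^ (- beta) <= 1 / 2 ->
  (I W mu r w + (m / 4)%:E <= J W mu r w
    + (M * (Num.min 1 (r / w) * kappa `^ (- eta) * w `^ (- beta)
       + kappa `^ (- eta * (beta' / beta)) * w `^ (- beta')))%:E)%E.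
Proof.
move=> /andP[k0 k1] kr w1 wbig.
set A := Num.min 1 (r / w) * kappa `^ (- eta) * w `^ (- beta).
set B := kappa `^ (- eta * (beta' / beta)) * w `^ (- beta').
have t0 : 0 <= Num.min 1 (r / w) by rewrite le_min ler01 divr_ge0 ?ltW.
have A0 : 0 <= A by rewrite !mulr_ge0 ?powR_ge0.
have B0 : 0 <= B by rewrite mulr_ge0 ?powR_ge0.
have l0 : 0 <= A + B + m / (4 * M) by rewrite !addr_ge0// divr_ge0// mulr_ge0// ltW.
have m20 : 0 <= m / 2 by rewrite divr_ge0.
have := @weight_law_le_integral W mu
  (fun u => accept r w u * drift_ratio r w u) (accept r w) (m / 2) _ Wmu mI
  (measurable_accept r w) I0 J0 m20 l0.
have -> : (A + B + m / (4 * M)) * M = M * (A + B) + m / 4.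
  by field; rewrite gt_eqF.
move=> h.
suff : (I W mu r w + (m / 2)%:E <= J W mu r w + (M * (A + B) + m / 4)%:E)%E.
  rewrite (_ : m / 2 = m / 4 + m / 4); last by lra.
  by rewrite !EFinD !addeA leeD2rE.
apply: h => u Wu; have u0 := W_gt0 Wu.
have a0 := J0 Wu; have a1 := accept_le1 r w u.
have psiw : psi w = w `^ beta by apply: two_sided_power_large => //; exact: ltW.
have rk : r `^ (- eta) <= kappa `^ (- eta).
  rewrite !powRN lef_pV2 ?posrE ?powR_gt0//.
  by apply: ge0_ler_powR; rewrite ?nnegrE//; exact: ltW.
have wb0 : 0 < w `^ (- beta) by rewrite powR_gt0.
have rho_le : drift_ratio r w u <= kappa `^ (- eta) * psi u * w `^ (- beta).
  rewrite /drift_ratio psiw -powRN mulrA ler_wpM2r ?powR_ge0//.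
  by rewrite ler_wpM2r// two_sided_power_ge0.
have psi_le : psi u <= psi' u.
  apply: two_sided_power_le => //; first by rewrite (ltW alpha_gt0).
  by rewrite (ltW beta_gt0)/= ltW// (lt_trans beta_lt)// gtrBl.
have [uM|uM] := leP (psi' u) (2 * M).
  have am := accept_typical u0 uM; rewrite -/m in am.
  have rho2 : drift_ratio r w u <= 1 / 2.
    apply: (le_trans rho_le); apply: le_trans wbig.
    rewrite ler_wpM2r ?powR_ge0// ler_wpM2l ?powR_ge0//.
    exact: le_trans uM.
  have lpsi : 0 <= (A + B + m / (4 * M)) * psi' u by rewrite mulr_ge0.
  have : accept r w u * drift_ratio r w u <= accept r w u * (1 / 2).
    by rewrite ler_wpM2l.
  lra.
have mpsi : m / 2 <= m / (4 * M) * psi' u.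
  have -> : m / 2 = m / (4 * M) * (2 * M) by field; rewrite gt_eqF.
  by rewrite ler_wpM2l ?(ltW uM)// divr_ge0// mulr_ge0// ltW.
suff : accept r w u * drift_ratio r w u <= accept r w u + (A + B) * psi' u by lra.
have Apsi : 0 <= A * psi' u by rewrite mulr_ge0.
have Bpsi : 0 <= B * psi' u by rewrite mulr_ge0.
have [u1|u1] := leP u 1.
  have at_ : accept r w u <= Num.min 1 (r / w).
    rewrite le_min accept_le1/= ge_min; apply/orP; right.
    by rewrite ler_pM2l// ler_piMl// invr_ge0 ltW.
  suff : accept r w u * drift_ratio r w u <= A * psi' u by lra.
  apply: (@le_trans _ _ (Num.min 1 (r / w) *
      (kappa `^ (- eta) * psi u * w `^ (- beta)))).
    by rewrite ler_pM// drift_ratio_ge0.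
  rewrite [leRHS](_ : _ = Num.min 1 (r / w) *
      (kappa `^ (- eta) * psi' u * w `^ (- beta))); last by rewrite /A; ring.
  by rewrite ler_wpM2l// ler_wpM2r ?powR_ge0// ler_wpM2l ?powR_ge0.
have [rho1|rho1] := leP (drift_ratio r w u) 1.
  have : accept r w u * drift_ratio r w u <= accept r w u * 1 by rewrite ler_wpM2l.
  lra.
(* X >= 1, so X is at most X ^ (beta' / beta), which has the exponent beta'
   of the moment function. *)
set X := kappa `^ (- eta) * u `^ beta * w `^ (- beta).
have rX : drift_ratio r w u <= X.
  apply: (le_trans rho_le); rewrite (two_sided_power_large (ltW alpha_gt0))// ltW//.
have X1 : 1 <= X by apply: le_trans rX; exact: ltW.
have bb : 1 <= beta' / beta by rewrite ler_pdivlMr// mul1r ltW// (lt_trans beta_lt)// gtrBl.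
have XE : X `^ (beta' / beta) = B * u `^ beta'.
  rewrite /X !powRM ?mulr_ge0 ?powR_ge0// -!powRrM /B.
  have -> : beta * (beta' / beta) = beta' by field; rewrite gt_eqF.
  have -> : - beta * (beta' / beta) = - beta' by field; rewrite gt_eqF.
  by ring.
have : X <= B * u `^ beta'.
  by rewrite -XE -[leLHS](powRr1 (le_trans ler01 X1)) ler_powR.
have : B * u `^ beta' <= B * psi' u.
  by rewrite ler_wpM2l// le_max lexx orbT.
have : accept r w u * drift_ratio r w u <= 1 * drift_ratio r w u.
  by rewrite ler_wpM2r// drift_ratio_ge0.
lra.
Qed.

End one_law.

Local Notation s := typical_weight.

Lemma accept_bound_ge kappa r w : 0 < kappa <= 1 -> kappa <= r ->
  0 < w <= s -> kappa <= Num.min 1 (r * (s / w)).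
Proof.
move=> /andP[k0 k1] kr /andP[w0 ws]; rewrite le_min k1/=.
apply: (le_trans kr); rewrite ler_peMr//; first exact: le_trans (ltW k0) kr.
by rewrite ler_pdivlMr// mul1r.
Qed.

(** Any e will do since w ^ (alpha - eta) tends to zero with w. *)
Lemma accepted_drift_small_weight (kappa e : R) : 0 < kappa <= 1 -> 0 < e ->
  exists2 wlow : R, 0 < wlow <= 1 &
    forall W (mu : {measure set R -> \bar R}) (r w : R),
      weight_law W mu -> 0 < r -> 0 < w <= wlow ->
      (I W mu r w <= J W mu r w + e%:E)%E /\
      (kappa <= r -> (I W mu r w + (kappa / 2)%:E <= J W mu r w + e%:E)%E).
Proof.
move=> k01 e0; have ae0 : 0 < alpha - eta by rewrite subr_gt0.
have [w1 /andP[w10 w11] w1e] := powR_decay_small M e0 ae0.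
have s0 := typical_weight_gt0.
exists (Num.min w1 s).
  by rewrite lt_min w10 s0 ge_min w11.
move=> W mu r w Wmu r0 /andP[w0]; rewrite le_min => /andP[ww1 ws].
have w_le1 : w <= 1 by apply: le_trans ww1 w11.
have eta01 : 0 <= eta <= 1 by rewrite !ltW.
have etab : eta + beta <= beta' by have := beta_lt; lra.
have Ie : (I W mu r w <= e%:E)%E.
  apply: (le_trans (accepted_drift_le Wmu r0 w0 eta01 etab)).
  rewrite lee_fin subrr powRr0 mul1r.
  rewrite (two_sided_power_small (ltW alpha_gt0) (ltW beta_gt0)); last by rewrite w0.
  rewrite -powRN opprK -powRD; last by apply/implyP => _; rewrite gt_eqF.
  by rewrite mulrC [- eta + _]addrC w1e// w0.
have J0 : (0 <= J W mu r w)%E.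
  case: Wmu => _ W0 _ _; apply: integral_ge0 => u Wu.
  by rewrite lee_fin accept_ge0// W0.
split; first by rewrite -[leLHS]add0e leeD.
move=> kr; rewrite addeC leeD//.
apply: le_trans (accepted_mass_ge Wmu r0 w0).
rewrite lee_fin ler_wpM2r ?invr_ge0//.
by apply: accept_bound_ge => //; rewrite w0.
Qed.

(** The exponent beta + p of the decay in w given by [accepted_drift_le] for the
    largest admissible p. *)
Definition decay_exponent : R := beta + Num.min 1 (beta' - beta).

Let p0 := Num.min 1 (beta' - beta).

Let p0_gt_eta : eta < p0.
Proof. by rewrite lt_min eta_lt1/=; have := beta_lt; lra. Qed.

Let p0_01 : 0 <= p0 <= 1.
Proof. by rewrite ge_min lexx andbT (le_trans (ltW eta_gt0))// ltW. Qed.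

Let p0_beta : p0 + beta <= beta'.
Proof. by rewrite -lerBrDr ge_min lexx orbT. Qed.

Lemma decay_exponent_gt1 : 1 < decay_exponent.
Proof.
rewrite /decay_exponent; case: (leP 1 (beta' - beta)) => _.
  by rewrite ltrDr.
by rewrite addrC subrK.
Qed.

(** The gain 1 / w beats the loss since the decay exponent exceeds 1. *)
Lemma accepted_drift_large_weight (kappa : R) : 0 < kappa <= 1 ->
  exists2 wbar : R, 1 <= wbar &
    forall W (mu : {measure set R -> \bar R}) (r w : R),
      weight_law W mu -> 0 < r -> wbar <= w ->
      (I W mu r w <= J W mu r w + (M * w `^ (- decay_exponent))%:E)%E /\
      (kappa <= r ->
        (I W mu r w + (s * kappa / 8 / w)%:E <= J W mu r w)%E).
Proof.
move=> /[dup] k01 /andP[k0 k1].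
have s0 := typical_weight_gt0.
have kp0 : 0 < kappa `^ (- eta) by rewrite powR_gt0.
have half0 : 0 < 1 / 2 :> R by [].
have [w1 w1_ge1 w1P] := powR_decay_large (kappa `^ (- eta) * (2 * M)) half0 beta_gt0.
have s16 : 0 < s / 16 by rewrite divr_gt0.
have [w2 w2_ge1 w2P] := powR_decay_large (M * kappa `^ (- eta)) s16 beta_gt0.
have sk16 : 0 < s * kappa / 16 by rewrite divr_gt0// mulr_gt0.
have b'1 : 0 < beta' - 1 by rewrite subr_gt0.
have [w3 w3_ge1 w3P] :=
  powR_decay_large (M * kappa `^ (- eta * (beta' / beta))) sk16 b'1.
exists (Num.max w1 (Num.max w2 w3)); first by rewrite le_max w1_ge1.
move=> W mu r w Wmu r0; rewrite !ge_max => /and3P[ww1 ww2 ww3].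
have w1' : 1 <= w by apply: le_trans ww1.
have w0 : 0 < w by apply: lt_le_trans w1'.
have J0 : (0 <= J W mu r w)%E.
  case: Wmu => _ W0 _ _; apply: integral_ge0 => u Wu.
  by rewrite lee_fin accept_ge0// W0.
have large : kappa <= r ->
    (I W mu r w + (s * kappa / 8 / w)%:E <= J W mu r w)%E.
  move=> kr; have := accepted_drift_large Wmu r0 w0 k01 kr w1' (w1P _ ww1).
  set m := Num.min 1 (r * (s / w)); set t := Num.min 1 (r / w).
  set A := kappa `^ (- eta) in kp0 w2P *; set B := kappa `^ (- eta * _) in w3P *.
  move=> IJ.
  have tk : kappa / w <= t.
    rewrite le_min ler_pM2r ?invr_gt0// kr andbT.
    by rewrite ler_pdivrMr// mul1r (le_trans k1).
  have t0 : 0 <= t by apply: le_trans tk; rewrite divr_ge0// ltW.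
  have mt : s * t <= m.
    rewrite /m /t le_min; apply/andP; split.
      by rewrite mulr_ile1 ?(ltW s0)// ?typical_weight_le1// ge_min lexx.
    by rewrite mulrCA ler_pM2l// ge_min lexx orbT.
  have MA : M * (t * A * w `^ (- beta)) <= t * (s / 16).
    rewrite [leLHS](_ : _ = t * (M * A * w `^ (- beta))); last by ring.
    by rewrite ler_wpM2l// w2P.
  have MB : M * (B * w `^ (- beta')) <= s * (kappa / w) / 16.
    have -> : w `^ (- beta') = w `^ (- (beta' - 1)) / w.
      rewrite -(powR_inv1 (ltW w0)) -powRD; last by apply/implyP => _; rewrite gt_eqF.
      by congr (_ `^ _); ring.
    rewrite [leLHS](_ : _ = M * B * w `^ (- (beta' - 1)) / w); last by ring.
    rewrite [leRHS](_ : _ = s * kappa / 16 / w); last by ring.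
    by rewrite ler_wpM2r ?invr_ge0 ?(ltW w0)// w3P.
  have st : s * (kappa / w) <= s * t by rewrite ler_pM2l.
  set c := M * _ in IJ.
  rewrite -(@leeD2rE _ c%:E)//; apply: le_trans IJ.
  rewrite -addeA leeD2l// -EFinD lee_fin.
  have cE : c = M * (t * A * w `^ (- beta)) + M * (B * w `^ (- beta')).
    by rewrite /c mulrDr.
  have -> : s * kappa / 8 / w = s * (kappa / w) / 8 by ring.
  lra.
split => //.
have c0 : 0 <= M * w `^ (- decay_exponent) by rewrite mulr_ge0 ?powR_ge0// ltW.
have [kr|rk] := leP kappa r.
  apply: (@le_trans _ _ (J W mu r w)); last by rewrite leeDl.
  apply: le_trans (large kr); rewrite leeDl// lee_fin.
  by rewrite divr_ge0 ?divr_ge0 ?mulr_ge0 ?(ltW s0) ?(ltW k0) ?(ltW w0).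
apply: (@le_trans _ _ (M * w `^ (- decay_exponent))%:E); last by rewrite leeDr.
apply: (le_trans (accepted_drift_le Wmu r0 w0 p0_01 p0_beta)); rewrite lee_fin.
rewrite (two_sided_power_large (ltW alpha_gt0) (ltW beta_gt0) w1') -powRN.
rewrite [leLHS](_ : _ = r `^ (p0 - eta) * (w `^ (- p0) * w `^ (- beta)) * M);
  last by ring.
rewrite -powRD; last by apply/implyP => _; rewrite gt_eqF.
rewrite mulrC ler_pM2l//.
have -> : - p0 - beta = - decay_exponent by rewrite /decay_exponent -/p0; ring.
rewrite ler_piMl ?powR_ge0//.
rewrite -[leRHS](powRr0 r) ger_powR//; first by rewrite r0 ltW// (lt_le_trans rk).
by rewrite subr_ge0 ltW.
Qed.

(** On a bounded range of weights, everything is driven by r: the bound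
    [accepted_drift_le] with p > eta handles r small, p = eta gives the constant C,
    and p = 0 handles r large. *)
Lemma accepted_drift_mid_weight (wlow wbar e : R) : 0 < wlow -> 0 < e ->
  exists K C : R, [/\ 1 <= K, 0 <= C &
    forall W (mu : {measure set R -> \bar R}) (r w : R),
      weight_law W mu -> 0 < r -> wlow <= w <= wbar ->
      [/\ (I W mu r w <= J W mu r w + C%:E)%E,
          r <= K^-1 -> (I W mu r w <= J W mu r w + e%:E)%E &
          K <= r -> (I W mu r w + (1 / 2)%:E <= J W mu r w + e%:E)%E]].
Proof.
move=> wl0 e0; have s0 := typical_weight_gt0.
have pe0 : 0 < p0 - eta by rewrite subr_gt0.
have [r1 /andP[r10 r11] r1P] := powR_decay_small (M * wlow `^ (- p0)) e0 pe0.
have [r2 r2_ge1 r2P] := powR_decay_large M e0 eta_gt0.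
exists (Num.max r1^-1 (Num.max r2 (wbar / s))), (M * wlow `^ (- eta)); split.
- by rewrite !le_max r2_ge1 orbT.
- by rewrite mulr_ge0 ?powR_ge0// ltW.
move=> W mu r w Wmu r0 /andP[wlw wwb].
have w0 : 0 < w by apply: lt_le_trans wlw.
have J0 : (0 <= J W mu r w)%E.
  case: Wmu => _ W0 _ _; apply: integral_ge0 => u Wu.
  by rewrite lee_fin accept_ge0// W0.
have upper p : 0 <= p <= 1 -> p + beta <= beta' ->
    (I W mu r w <= (M * wlow `^ (- p) * r `^ (p - eta))%:E)%E.
  move=> /[dup] p01 /andP[p0' _] pb.
  apply: (le_trans (accepted_drift_le Wmu r0 w0 p01 pb)); rewrite lee_fin.
  rewrite [leRHS](_ : _ = r `^ (p - eta) * wlow `^ (- p) * M); last by ring.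
  rewrite ler_pM2r// -mulrA ler_wpM2l ?powR_ge0//.
  apply: (@le_trans _ _ (w `^ (- p))).
    by rewrite ler_pdivrMr ?psi_gt0// ler_peMr ?powR_ge0// psi_ge1.
  rewrite !powRN lef_pV2 ?posrE ?powR_gt0//.
  by apply: ge0_ler_powR; rewrite ?nnegrE//; exact: ltW.
have addJ (c : R) : (I W mu r w <= c%:E -> I W mu r w <= J W mu r w + c%:E)%E.
  by move=> Ic; rewrite -[leLHS]add0e leeD.
split.
- apply: addJ; have := upper eta; rewrite subrr powRr0 mulr1; apply.
    by rewrite !ltW.
  by have := beta_lt; lra.
- move=> rK; apply: addJ; apply: (le_trans (upper p0 p0_01 p0_beta)).
  rewrite lee_fin r1P// r0/= -[leRHS]invrK; apply: (le_trans rK).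
  by rewrite lef_pV2 ?posrE ?invr_gt0 ?lt_max ?invr_gt0 ?r10// le_max lexx.
rewrite !ge_max => /and3P[_ rr2 rwb]; rewrite addeC leeD//; last first.
  have z01 : 0 <= (0 : R) <= 1 by rewrite lexx ler01.
  have b'b : 0 + beta <= beta' by have := beta_lt; have := eta_gt0; lra.
  apply: (le_trans (upper 0 z01 b'b)).
  by rewrite lee_fin oppr0 powRr0 mulr1 sub0r r2P.
apply: le_trans (accepted_mass_ge Wmu r0 w0).
rewrite lee_fin ler_pM2r ?invr_gt0// le_min lexx/=.
rewrite mulrA ler_pdivlMr// mul1r (le_trans wwb)//.
by rewrite -ler_pdivrMr.
Qed.

End weight_estimates.

(** * The Lyapunov function *)

Section lyapunov.
Context {R : realType} {d : nat}.
Variables (pi q : 'rV[R]_d -> R) (alpha' beta' eta alpha beta M : R).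
Hypothesis mpi : measurable_fun setT pi.
Hypothesis pi_gt0 : forall x, 0 < pi x.
Hypothesis pi_bounded : exists2 B : R, 0 < B & forall x, pi x <= B.
Hypothesis q_density : probability_density q.
Hypotheses (alpha_gt0 : 0 < alpha) (beta_gt0 : 0 < beta) (eta_gt0 : 0 < eta).

Local Notation V := (pm_lyapunov pi eta alpha beta).
Local Notation psi := (two_sided_power alpha beta).

Let cpi := sup (range pi).

Lemma le_sup_pi x : pi x <= cpi.
Proof.
have [B B0 BP] := pi_bounded.
by apply: ub_le_sup; [exists B => _ [y _ <-]|exists x].
Qed.

Lemma sup_pi_gt0 : 0 < cpi.
Proof. exact: lt_le_trans (pi_gt0 0) (le_sup_pi 0). Qed.

Lemma pm_lyapunov_gt0 z : 0 < z.2 -> 0 < V z.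
Proof.
move=> z0; rewrite /pm_lyapunov -/cpi -/(psi z.2).
rewrite !mulr_gt0 ?powR_gt0 ?sup_pi_gt0//.
exact: lt_le_trans (two_sided_power_ge1 (ltW alpha_gt0) (ltW beta_gt0) z0).
Qed.

(** The normalisation by the supremum of pi makes the density factor at least 1. *)
Lemma pm_lyapunov_ge_weight z : 0 < z.2 -> psi z.2 <= V z.
Proof.
move=> z0; rewrite /pm_lyapunov -/cpi -/(psi z.2).
rewrite ler_peMl ?two_sided_power_ge0// powRN ler_pdivlMr ?powR_gt0// mul1r.
by apply: ge0_ler_powR; rewrite ?nnegrE ?le_sup_pi// ltW// sup_pi_gt0.
Qed.

Lemma pm_lyapunov_ge1 z : 0 < z.2 -> 1 <= V z.
Proof.
move=> z0; apply: le_trans (pm_lyapunov_ge_weight z0).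
by apply: two_sided_power_ge1 => //; exact: ltW.
Qed.

Lemma measurable_pm_lyapunov : measurable_fun setT V.
Proof.
apply: measurable_funM.
  apply: measurable_funM => //.
  apply: (@measurableT_comp _ _ _ _ _ _ (fun t : R => t `^ (- eta))).
    exact: measurable_powR.
  exact: (measurableT_comp mpi measurable_fst).
apply: (@measurableT_comp _ _ _ _ _ _ psi); last exact: measurable_snd.
exact: measurable_two_sided_power.
Qed.

Lemma pm_lyapunov_ratio x w y u :
  V (y, u) / V (x, w) = drift_ratio eta alpha beta (pi y / pi x) w u.
Proof.
rewrite /pm_lyapunov/= -/cpi -/(psi u) -/(psi w) /drift_ratio.
have piV : 0 <= (pi x)^-1 by rewrite invr_ge0 ltW.
rewrite powRM ?(ltW (pi_gt0 y))//.
have -> : (pi x)^-1 `^ (- eta) = (pi x `^ (- eta))^-1.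
  by rewrite -(powR_inv1 (ltW (pi_gt0 x))) -powRrM mulN1r [LHS]powRN.
have c0 : cpi `^ eta != 0 by rewrite gt_eqF// powR_gt0// sup_pi_gt0.
have p0 : pi x `^ (- eta) != 0 by rewrite gt_eqF// powR_gt0.
rewrite !invfM; set X := (psi w)^-1; set Y := pi y `^ _; set Z := psi u.
by field; rewrite c0 p0.
Qed.

Section one_kernel.
Variables (W : set R) (Q : R.-pker 'rV[R]_d ~> R).
Hypothesis WQ : weight_kernel W Q.
Hypothesis lawQ : \forall y \ae lebesgue_rV d, weight_law alpha' beta' M W (Q y).
Variables (x : 'rV[R]_d) (w : R).
Hypothesis Ww : W w.

Let w_gt0 : 0 < w.
Proof. by case: WQ => _ /(_ w Ww) /=; rewrite in_itv/= andbT. Qed.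

Lemma pm_lyapunov_drift (f g : 'rV[R]_d -> R) (a b : R) :
  measurable_fun setT f -> (forall y, 0 <= f y) ->
  measurable_fun setT g -> (forall y, 0 <= g y) ->
  (forall y, weight_law alpha' beta' M W (Q y) ->
    accepted_drift eta alpha beta W (Q y) (pi y / pi x) w + (f y)%:E
    <= accepted_mass W (Q y) (pi y / pi x) w + (g y)%:E)%E ->
  (a%:E <= \int[lebesgue_rV d]_y (q (y - x)%R * f y)%:E)%E ->
  (\int[lebesgue_rV d]_y (q (y - x)%R * g y)%:E <= b%:E)%E ->
  (pm_apply pi q W Q V (x, w) <= (V (x, w) * (1 + b - a))%:E)%E.
Proof.
move=> mf f0 mg g0 fg af gb.
apply: (pm_drift mpi pi_gt0 q_density WQ Ww measurable_pm_lyapunov _ _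
  mf f0 mg g0 _ af gb).
- move=> z; rewrite /pm_lyapunov -/cpi -/(psi z.2).
  by rewrite mulr_ge0 ?two_sided_power_ge0 ?mulr_ge0 ?powR_ge0.
- exact: pm_lyapunov_gt0.
apply: filterS lawQ => y /fg; congr (_ <= _)%E; congr (_ + _)%E.
by apply: eq_integral => u _; rewrite pm_lyapunov_ratio.
Qed.

Let q0 v : 0 <= q v. Proof. by case: q_density. Qed.
Let mqx : measurable_fun setT (fun y : 'rV[R]_d => q (y - x)) := measurable_proposal q_density x.

Lemma proposal_mass_cst (k : R) : 0 <= k ->
  (\int[lebesgue_rV d]_y (q (y - x)%R * k)%:E = k%:E)%E.
Proof.
move=> k0; under eq_integral do rewrite mulrC EFinM.
rewrite ge0_integralZl//.
- by rewrite proposal_mass// mule1.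
- exact/measurable_EFinP.
- by move=> y _; rewrite lee_fin.
Qed.

Lemma proposal_mass_indic (k : R) (D : set 'rV[R]_d) : 0 <= k -> measurable D ->
  (\int[lebesgue_rV d]_y (q (y - x)%R * (k * \1_D y))%:E =
   k%:E * \int[lebesgue_rV d]_y (q (y - x)%R * \1_D y)%:E)%E.
Proof.
move=> k0 mD; rewrite -ge0_integralZl//.
- by apply: eq_integral => y _; rewrite -EFinM mulrCA.
- by apply/measurable_EFinP; apply: measurable_funM => //; exact: measurable_indic.
- by move=> y _; rewrite lee_fin mulr_ge0.
Qed.

(** The form taken when one region of proposals brings a gain and the loss is
    uniform, as it is for small and for large weights. *)
Lemma pm_drift_region (D : set 'rV[R]_d) (k e m : R) :
  measurable D -> 0 <= k -> 0 <= e ->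
  (m%:E <= \int[lebesgue_rV d]_y (q (y - x)%R * \1_D y)%:E)%E ->
  (forall y, weight_law alpha' beta' M W (Q y) ->
    (accepted_drift eta alpha beta W (Q y) (pi y / pi x) w
      <= accepted_mass W (Q y) (pi y / pi x) w + e%:E)%E /\
    (D y -> (accepted_drift eta alpha beta W (Q y) (pi y / pi x) w + k%:E
      <= accepted_mass W (Q y) (pi y / pi x) w + e%:E)%E)) ->
  (pm_apply pi q W Q V (x, w) <= (V (x, w) * (1 + e - k * m))%:E)%E.
Proof.
move=> mD k0 e0 mass IJ.
apply: (@pm_lyapunov_drift (fun y => k * \1_D y) (fun=> e)).
- by apply: measurable_funM => //; exact: measurable_indic.
- by move=> y; rewrite mulr_ge0.
- exact: measurable_cst.
- by [].
- move=> y /IJ[I1 I2]; rewrite indicE; have [Dy|Dy] := boolP (y \in D).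
    by rewrite mulr1; apply: I2; rewrite -in_setE.
  by rewrite mulr0 adde0.
- by rewrite proposal_mass_indic// EFinM lee_wpmul2l// lee_fin.
- by rewrite proposal_mass_cst.
Qed.

End one_kernel.
End lyapunov.

(** * The drift inequality *)

Section polynomial_rate.
Context {R : realType}.
Variable beta : R.
Hypothesis beta_gt0 : 0 < beta.

Lemma powR_rate_le1 (v : R) : 1 <= v -> v `^ ((beta - 1) / beta) <= v.
Proof.
move=> v1; apply: ler1_powR => //.
by rewrite ler_pdivrMr// mul1r lerBlDr lerDl.
Qed.

(** As w <= v ^ (1 / beta), the decrease v / w is at least v ^ (1 - 1 / beta). *)
Lemma powR_rate_le_div (v w : R) : 1 <= v -> 0 < w -> w `^ beta <= v ->
  v `^ ((beta - 1) / beta) <= v / w.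
Proof.
move=> v1 w0 wv; have v0 : 0 < v by apply: lt_le_trans v1.
have -> : (beta - 1) / beta = 1 - beta^-1 by field; rewrite gt_eqF.
rewrite powRD; last by apply/implyP => _; rewrite gt_eqF.
rewrite (powRr1 (ltW v0)) powRN ler_pM2l// lef_pV2 ?posrE ?powR_gt0//.
rewrite -[leLHS](powRr1 (ltW w0)) -(@mulfV _ beta) ?gt_eqF// powRrM.
by apply: ge0_ler_powR; rewrite ?nnegrE ?powR_ge0 ?invr_ge0// ltW.
Qed.

End polynomial_rate.

Theorem theorem38 (R : realType) (d : nat) (d_gt0 : (0 < d)%N)
    (pi q : 'rV[R]_d -> R) (alpha' beta' MW eta alpha beta : R)
    (alpha'_gt0 : 0 < alpha') (beta'_gt1 : 1 < beta')
    (pi_density : probability_density pi)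
    (pi_gt0 : forall x, 0 < pi x)
    (pi_C1 : C1 pi)
    (pi_tail : dotr (unitv x) (gradient (fun y => ln (pi y)) x)
                 @[x --> infty_nbhs] --> -oo)
    (pi_contour :
       (limf_esup (fun x => (dotr (unitv x) (unitv (gradient pi x)))%:E)
          infty_nbhs < 0)%E)
    (q_density : probability_density q)
    (q_symmetric : forall z, q (- z) = q z)
    (q_near0 : exists2 e : R, 0 < e & \forall z \near (0 : 'rV[R]_d), e <= q z)
    (eta_gt0 : 0 < eta) (eta_lt : eta < Num.min alpha' 1)
    (alpha_gt : eta < alpha) (alpha_le : alpha <= alpha')
    (beta_gt0 : 0 < beta) (beta_lt : beta < beta' - eta) :
  exists wbar M b wlow delta : R,
    [/\ 1 <= wbar, 1 <= M, 1 <= b, 0 < wlow <= 1 & 0 < delta] /\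
    forall (W : set R) (Q : R.-pker 'rV[R]_d ~> R),
      weight_kernel W Q ->
      ess_sup (lebesgue_rV d)
        (fun x => \int[Q x]_(w in W)
           (Num.max (w `^ (- alpha')) (w `^ beta'))%:E)%E = MW%:E ->
      let V := pm_lyapunov pi eta alpha beta in
      let C := [set z : 'rV[R]_d * R |
                 [/\ W z.2, enorm z.1 <= M & wlow <= z.2 <= wbar]] in
      forall z : 'rV[R]_d * R, W z.2 ->
        (~ C z -> (pm_apply pi q W Q V z <=
                   (V z - delta * V z `^ ((beta - 1) / beta))%:E)%E) /\
        (C z -> (pm_apply pi q W Q V z <= b%:E)%E).
Proof.
have [mpi _ _] := pi_density.
have eta_lt1 : eta < 1 by move: eta_lt; rewrite lt_min => /andP[].
have alpha_gt0 : 0 < alpha by apply: lt_trans alpha_gt.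
pose M := Num.max MW 1.
have M1 : 1 <= M by rewrite le_max lexx orbT.
have piB := pi_bounded pi_gt0 pi_C1 pi_tail pi_contour.
have [m m0 [far [kappa k01 near]]] :=
  superlevel_mass pi_gt0 mpi pi_C1 pi_tail pi_contour q_density q_near0.
have /andP[k0 k1] := k01.
(* The gain kappa m / 2 is halved by the loss e. *)
have e10 : 0 < kappa * m / 4 by rewrite divr_gt0// mulr_gt0.
have [wlow wlow01 smallP] := accepted_drift_small_weight alpha'_gt0
  eta_gt0 eta_lt1 alpha_gt alpha_le beta_gt0 beta_lt M1 k01 e10.
have /andP[wlow0 _] := wlow01.
have [wbar1 wbar1_ge1 largeP] := accepted_drift_large_weight alpha'_gt0 beta'_gt1
  eta_gt0 eta_lt1 alpha_gt alpha_le beta_gt0 beta_lt M1 k01.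
pose cl := typical_weight alpha' M * kappa / 8.
have cl0 : 0 < cl.
  by rewrite divr_gt0// mulr_gt0// typical_weight_gt0.
have E1 : 0 < decay_exponent beta' beta - 1.
  by rewrite subr_gt0 (decay_exponent_gt1 beta'_gt1 beta_gt0).
have clm : 0 < cl * m / 2 by rewrite divr_gt0// mulr_gt0.
have [wbar2 wbar2_ge1 decP] := powR_decay_large M clm E1.
pose wbar := Num.max wbar1 wbar2.
have wbar_ge1 : 1 <= wbar by rewrite le_max wbar1_ge1.
(* With e = m / 8, the losses e and C eps together are at most half the
   gain m / 2. *)
have m80 : 0 < m / 8 by rewrite divr_gt0.
have [K [C [K1 C0 midP]]] := accepted_drift_mid_weight alpha'_gt0
  eta_gt0 eta_lt1 alpha_gt alpha_le beta_gt0 beta_lt M1 wbar wlow0 m80.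
have K0 : 0 < K by apply: lt_le_trans K1.
have [r1 _ farP] := far K K1.
(* C + 1 instead of C, which may vanish. *)
have eps0 : 0 < m / 8 / (C + 1) by rewrite divr_gt0// ltr_wpDl.
have [r2 _ midmass] := near_level_mass pi_gt0 mpi pi_C1 pi_tail pi_contour
  q_density K1 eps0.
pose Mr := Num.max 1 (Num.max r1 r2).
pose delta := Num.min (kappa * m / 4) (Num.min (cl * m / 2) (m / 4)).
have delta0 : 0 < delta by rewrite !lt_min e10 clm divr_gt0.
have cV : continuous (fun x => (pi x)^-1).
  move=> x; have pix : pi x != 0 by rewrite gt_eqF.
  exact: (cvgV pix (continuous_density pi_C1 (x := x))).
have [B' B'P] := continuous_bounded_box Mr cV.
(* The density factor of V is bounded on the compact set by continuity of 1 / pi,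
   its weight factor by the values at both ends of the weight range. *)
pose b := Num.max 1 (sup (range pi) `^ eta * Num.max B' 0 `^ eta *
  (wlow `^ (- alpha) + wbar `^ beta) * (1 + C)).
exists wbar, Mr, b, wlow, delta; split.
  by split=> //; rewrite /Mr/b le_max lexx.
move=> W Q WQ essQ V Cset [x w] /= Ww.
have lawQ : \forall y \ae lebesgue_rV d, weight_law alpha' beta' M W (Q y).
  have := @ess_sup_ge _ _ _ (lebesgue_rV d)
    (fun x => \int[Q x]_(w in W) (Num.max (w `^ (- alpha')) (w `^ beta'))%:E)%E.
  rewrite essQ; apply: filterS => y yMW.
  have [mW W0 _ _] := WQ; split => //.
  - by move=> u /W0 /=; rewrite in_itv/= andbT.
  - exact: weight_setW.
  - by apply: le_trans yMW _; rewrite lee_fin le_max lexx.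
have w0 : 0 < w by case: WQ => _ /(_ w Ww) /=; rewrite in_itv/= andbT.
have V1 : 1 <= V (x, w) by exact: pm_lyapunov_ge1.
have V0 : 0 < V (x, w) by apply: lt_le_trans V1.
have Vrate := powR_rate_le1 beta_gt0 V1.
have rate0 : 0 <= V (x, w) `^ ((beta - 1) / beta) by exact: powR_ge0.
have ratio0 y : 0 < pi y / pi x by rewrite divr_gt0.
have mS k : measurable (superlevel pi k x) by exact: measurable_superlevel.
have superE k y : superlevel pi k x y -> k <= pi y / pi x.
  by rewrite /superlevel/= ler_pdivlMr.
(* As V >= 1, V ^ ((beta - 1) / beta) is at most V. *)
have geometric c : delta <= c -> (pm_apply pi q W Q V (x, w) <=
    (V (x, w) * (1 - c))%:E)%E -> (pm_apply pi q W Q V (x, w) <=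
    (V (x, w) - delta * V (x, w) `^ ((beta - 1) / beta))%:E)%E.
  move=> dc /le_trans; apply; rewrite lee_fin mulrBr mulr1 lerB//.
  by rewrite mulrC ler_pM// ltW.
have drift D k e m' := pm_drift_region mpi pi_gt0 piB q_density alpha_gt0 beta_gt0
  WQ lawQ Ww (eta := eta) (x := x) (D := D) (k := k) (e := e) (m := m').
have [wlow_w|w_wlow] := leP wlow w; last first.
  split; last by case=> _ _ /andP[/le_lt_trans/(_ w_wlow)]; rewrite ltxx.
  move=> _; apply: (geometric (kappa * m / 4)); first by rewrite ge_min lexx.
  have := drift _ (kappa / 2) (kappa * m / 4) m (mS kappa) _ _ (near x) _.
  have -> : 1 + kappa * m / 4 - kappa / 2 * m = 1 - kappa * m / 4 by lra.
  apply; [by rewrite divr_ge0// ltW|exact: ltW|].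
  move=> y lawy; have [|I1 I2] := smallP _ _ (pi y / pi x) w lawy (ratio0 y).
    by rewrite w0 ltW.
  by split => // /superE; exact: I2.
have [w_wbar|wbar_w] := leP w wbar; last first.
  split; last by case=> _ _ /andP[_ /(lt_le_trans wbar_w)]; rewrite ltxx.
  move=> _.
  have [w1 w2] : wbar1 <= w /\ wbar2 <= w.
    by move: (ltW wbar_w); rewrite ge_max => /andP[].
  have w_ge1 : 1 <= w by apply: le_trans w1.
  have Edec : M * w `^ (- decay_exponent beta' beta) <= cl * m / 2 / w.
    have -> : w `^ (- decay_exponent beta' beta) =
        w `^ (- (decay_exponent beta' beta - 1)) / w.
      rewrite -(powR_inv1 (ltW w0)) -powRD; last by apply/implyP => _; rewrite gt_eqF.
      by congr (_ `^ _); ring.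
    by rewrite mulrA ler_wpM2r ?invr_ge0 ?(ltW w0)// decP.
  have Ege0 : 0 <= M * w `^ (- decay_exponent beta' beta).
    by rewrite mulr_ge0 ?powR_ge0// (le_trans ler01).
  have := drift _ (cl / w) (M * w `^ (- decay_exponent beta' beta)) m
    (mS kappa) _ Ege0 (near x) _.
  set c := (V (x, w) * _)%:E => Vc.
  have {}Vc : (pm_apply pi q W Q V (x, w) <= c)%E.
    apply: Vc; first by rewrite divr_ge0// ltW.
    move=> y lawy; have [I1 I2] := largeP _ _ (pi y / pi x) w lawy (ratio0 y) w1.
    split => // /superE /I2 /le_trans; apply; rewrite leeDl// lee_fin//.
  apply: (le_trans Vc); rewrite lee_fin.
  have wV : w `^ beta <= V (x, w).
    have h := @pm_lyapunov_ge_weight _ _ _ eta alpha beta pi_gt0 piB eta_gt0 (x, w) w0.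
    apply: le_trans h.
    by rewrite le_max lexx orbT.
  have := powR_rate_le_div beta_gt0 V1 w0 wV.
  set v := V (x, w) in V0 V1 Vrate rate0 *; set p := v `^ _ => pvw.
  have dcl : delta <= cl * m / 2 by rewrite !ge_min lexx orbT.
  have h1 : delta * p <= cl * m / 2 * (v / w) by rewrite ler_pM// ltW.
  have h2 : v * (M * w `^ (- decay_exponent beta' beta)) <= v * (cl * m / 2 / w).
    by rewrite ler_pM2l.
  have -> : v * (1 + M * w `^ (- decay_exponent beta' beta) - cl / w * m) =
    v + v * (M * w `^ (- decay_exponent beta' beta)) - cl * m * (v / w) by ring.
  have h3 : v * (cl * m / 2 / w) = cl * m / 2 * (v / w) by ring.
  lra.
have mid y (lawy : weight_law alpha' beta' M W (Q y)) :=
  midP _ _ (pi y / pi x) w lawy (ratio0 y) (introT andP (conj wlow_w w_wbar)).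
split; last first.
  case=> _ /= xMr _.
  have IC : (pm_apply pi q W Q V (x, w) <= (V (x, w) * (1 + C))%:E)%E.
    have := drift _ 0 C 0 (mS 1) (lexx _) C0 _ _; rewrite mul0r subr0; apply.
      by apply: integral_ge0 => y _; rewrite lee_fin mulr_ge0//; case: q_density.
    by move=> y /mid[I1 _ _]; rewrite adde0; split.
  apply: (le_trans IC); rewrite lee_fin le_max; apply/orP; right.
  rewrite ler_wpM2r ?addr_ge0// /V /pm_lyapunov/=.
  rewrite -!mulrA ler_wpM2l ?powR_ge0// ler_pM ?powR_ge0//.
  + by rewrite le_max powR_ge0.
  + have -> : pi x `^ (- eta) = (pi x)^-1 `^ eta.
      by rewrite -(powR_inv1 (ltW (pi_gt0 x))) -powRrM mulN1r.
    apply: ge0_ler_powR; rewrite ?nnegrE ?invr_ge0 ?(ltW eta_gt0) ?(ltW (pi_gt0 x))//.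
      by rewrite le_max lexx orbT.
    rewrite le_max; apply/orP; left; apply: B'P => i.
    exact: le_trans (coord_le_enorm _ _) xMr.
  + rewrite ge_max; apply/andP; split.
      apply: (@le_trans _ _ (wlow `^ (- alpha))); last by rewrite lerDl powR_ge0.
      rewrite !powRN lef_pV2 ?posrE ?powR_gt0//.
      by apply: ge0_ler_powR; rewrite ?nnegrE// ltW.
    apply: (@le_trans _ _ (wbar `^ beta)); last by rewrite lerDr powR_ge0.
    by apply: ge0_ler_powR; rewrite ?nnegrE// ?(ltW beta_gt0) ?(ltW w0)// (le_trans ler01).
move=> notC.
have [xr1 xr2] : r1 < enorm x /\ r2 < enorm x.
  suff : Mr < enorm x by rewrite !gt_max => /and3P[].
  by rewrite ltNge; apply/negP => xMr; apply: notC; split => //=; rewrite wlow_w.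
apply: (geometric (m / 4)); first by rewrite !ge_min lexx !orbT.
have mN : measurable (near_level pi K x) by exact: measurable_near_level.
have := pm_lyapunov_drift mpi pi_gt0 piB q_density alpha_gt0 beta_gt0 WQ lawQ Ww
  (eta := eta) (x := x)
  (f := fun y => 1 / 2 * \1_(superlevel pi K x) y)
  (g := fun y => m / 8 + C * \1_(near_level pi K x) y)
  (a := m / 2) (b := m / 4).
have -> : 1 + m / 4 - m / 2 = 1 - m / 4 by lra.
apply.
- by apply: measurable_funM => //; exact: measurable_indic.
- by move=> y; rewrite mulr_ge0.
- by apply: measurable_funD => //; apply: measurable_funM => //; exact: measurable_indic.
- by move=> y; rewrite addr_ge0 ?mulr_ge0// ltW.
- move=> y /mid[Ig Ilow Ihigh]; rewrite !indicE.
  have Cind : ((m / 8)%:E <= (m / 8 + C * (y \in near_level pi K x)%:R)%:E)%E.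
    by rewrite lee_fin lerDl mulr_ge0.
  have [Dy|Dy] := boolP (y \in superlevel pi K x).
    rewrite mulr1; apply: le_trans (leeD (lexx _) Cind).
    by apply: Ihigh; apply: superE; rewrite -in_setE.
  rewrite mulr0 adde0.
  have [Ny|Ny] := boolP (y \in near_level pi K x).
    rewrite mulr1; apply: (le_trans Ig); rewrite leeD2l// lee_fin lerDr.
    exact: ltW.
  rewrite mulr0 addr0; apply: Ilow.
  move: Dy Ny; rewrite !notin_setE /superlevel /near_level/= => Dy Ny.
  rewrite ler_pdivrMr// -[leRHS]mulrC ler_pdivlMr//.
  have [//|h] := leP (pi y * K) (pi x).
  exfalso; apply: Ny; split; last by rewrite mulrC ltW.
  by rewrite leNgt; apply/negP => h2; apply: Dy; exact: ltW.
- rewrite proposal_mass_indic// (_ : m / 2 = 1 / 2 * m); last by lra.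
  by rewrite EFinM; apply: lee_wpmul2l; [rewrite lee_fin|exact: farP].
- have q0 v : 0 <= q v by case: q_density.
  have mqx := measurable_proposal q_density x.
  under eq_integral do rewrite mulrDr EFinD.
  rewrite ge0_integralD//.
  + rewrite (proposal_mass_cst q_density x (ltW m80)) proposal_mass_indic//.
    rewrite (_ : m / 4 = m / 8 + m / 8); last by lra.
    rewrite EFinD leeD2l//.
    apply: (@le_trans _ _ (C%:E * (m / 8 / (C + 1))%:E)%E).
      by apply: lee_wpmul2l; [rewrite lee_fin|exact: midmass].
    rewrite -EFinM lee_fin mulrCA ler_piMr ?(ltW m80)//.
    by rewrite ler_pdivrMr ?mul1r ?lerDl// ltr_wpDl.
  + by move=> y _; rewrite lee_fin mulr_ge0// ltW.
  + by apply/measurable_EFinP; apply: measurable_funM.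
  + by move=> y _; rewrite lee_fin mulr_ge0// mulr_ge0.
  + apply/measurable_EFinP; apply: measurable_funM => //.
    by apply: measurable_funM => //; exact: measurable_indic.
Qed.
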